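(* Let $X$ and $Y$ be Banach spaces and let $(S,T)\in RP(X,Y)$ be a regular Fredholm pair whose case is $II-n$ with number $n=p=q-1\ge 2$. Then there is an adapted decomposition system $(X_1,X_2,\tilde X;Y_1,Y_2,\tilde Y)$ of $(S,T)$ such that, for the subspaces associated with it, $$X=\Big[X_1\oplus\bigoplus_{i=1}^{p}\mathbb N^i\Big]\oplus\Big[X_2^{p-1}\oplus\bigoplus_{i=1}^{p-2}\mathbb X_2^i\Big]\oplus[\tilde X_N\oplus\tilde X_2],$$ $$Y=\Big[Y_1\oplus\bigoplus_{j=1}^{p-1}\mathbb M^j\Big]\oplus\Big[Y_2^{p}\oplus\bigoplus_{j=1}^{p-1}\mathbb Y_2^j\Big]\oplus[\tilde Y_N\oplus\tilde Y_2],$$ and $S$ and $T$ act as follows (every ''$\xrightarrow{\cong}$'' being the indicated restriction, and an isomorphism of Banach spaces; items whose superscript index is less than $1$ are omitted): $S|_{X_1\oplus\bigoplus_{i=1}^{p}\mathbb N^i}\equiv 0$, $S\colon X_2^{p-1}\xrightarrow{\cong}Y_2^{p}$, $S\colon\mathbb X_2^i\xrightarrow{\cong}\mathbb M^{i+1}\oplus\mathbb Y_2^{i+1}$ for $i=1,\dots,p-2$, $S\colon\tilde X_N\xrightarrow{\cong}\mathbb M^1$, $S\colon\tilde X_2\xrightarrow{\cong}\mathbb Y_2^1$; $T|_{Y_1\oplus\bigoplus_{j=1}^{p-1}\mathbb M^j}\equiv 0$, $T\colon Y_2^{p}\xrightarrow{\cong}X_2^{p-1}$, $T\colon\mathbb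 Y_2^j\xrightarrow{\cong}\mathbb N^{j+1}\oplus\mathbb X_2^{j+1}$ for $j=1,\dots,p-3$, $T\colon\mathbb Y_2^{k}\xrightarrow{\cong}\mathbb N^{k+1}$ for $k=p-2,\,p-1$, $T\colon\tilde Y_N\xrightarrow{\cong}\mathbb N^1$, $T\colon\tilde Y_2\xrightarrow{\cong}\mathbb X_2^1$. In addition, if $p=2$, then $\mathbb X_2^1$ and $\tilde Y_2$ are null spaces.
   Context: $L(X,Y)$ is the space of bounded linear operators from $X$ to $Y$; $N(\cdot)$ and $R(\cdot)$ denote null space and range; $\mathbb N=\{1,2,\dots\}$, $\mathbb N_0=\mathbb N\cup\{0\}$. Regular Fredholm pairs. For $S\in L(X,Y)$, $T\in L(Y,X)$, $(S,T)$ is a Fredholm pair if $N(S)/(N(S)\cap R(T))$, $R(T)/(N(S)\cap R(T))$, $N(T)/(N(T)\cap R(S))$, $R(S)/(N(T)\cap R(S))$ are all finite dimensional. An operator $T\in L(Y,X)$ is regular if $T=TT'T$ for some $T'\in L(X,Y)$. $RP(X,Y)$ is the set of Fredholm pairs $(S,T)$ with both $S$ and $T$ regular. Number and case. Put $R_{S,0}=Y$, $R_{T,0}=X$, $R_{S,n+1}=S(R_{T,n})$, $R_{T,n+1}=T(R_{S,n})$ for $n\in\mathbb N_0$. These are decreasing sequences of subspaces, finite dimensional for $n\ge 2$. Let $p$ (resp. $q$) be the smallest element of $\mathbb N$ with $R_{S,p}=R_{S,p+k}$ (resp. $R_{T,q}=R_{T,q+k}$) for all $k\ge 0$; always $|p-q|\le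 1$. The number of $(S,T)$ is $n=\min\{p,q\}$, and its case is $I-n$ if $p=q$, $II-n$ if $p<q$, $III-n$ if $q<p$. Decomposition systems. A decomposition system of $(S,T)\in RP(X,Y)$ consists of finite dimensional subspaces $X_1,X_2\subseteq X$, $Y_1,Y_2\subseteq Y$ and closed subspaces $\tilde X\subseteq X$, $\tilde Y\subseteq Y$ with $N(S)=(N(S)\cap R(T))\oplus X_1$, $R(T)=(N(S)\cap R(T))\oplus X_2$, $X=((N(S)\cap R(T))\oplus X_1\oplus X_2)\oplus\tilde X$, $N(T)=(N(T)\cap R(S))\oplus Y_1$, $R(S)=(N(T)\cap R(S))\oplus Y_2$, $Y=((N(T)\cap R(S))\oplus Y_1\oplus Y_2)\oplus\tilde Y$. With it are associated, for $n\in\mathbb N$: $M^n=R_{S,n}\cap N(T)$, $N^n=R_{T,n}\cap N(S)$, $Y_2^n=R_{S,n}\cap Y_2$, $X_2^n=R_{T,n}\cap X_2$; $R_{\tilde S,1}=S(\tilde X)$, $R_{\tilde T,1}=T(\tilde Y)$, $R_{\tilde S,n+1}=S(R_{\tilde T,n})$, $R_{\tilde T,n+1}=T(R_{\tilde S,n})$; $\mathbb M^n=R_{\tilde S,n}\cap N(T)$, $\mathbb N^n=R_{\tilde T,n}\cap N(S)$, $\mathbb Y_2^n=R_{\tilde S,n}\cap Y_2^n$, $\mathbb X_2^n=R_{\tilde T,n}\cap X_2^n$ (here $\mathbb N^n$ is a subspace of $X$, not a power of the natural numbers); $\tilde X_N=\{x\in\tilde X: Sx\in\mathbb M^1\}$,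 $\tilde X_2=\{x\in\tilde X: Sx\in\mathbb Y_2^1\}$, $\tilde Y_N=\{y\in\tilde Y: Ty\in\mathbb N^1\}$, $\tilde Y_2=\{y\in\tilde Y: Ty\in\mathbb X_2^1\}$. The system is called adapted if for all $n\in\mathbb N$: $R_{S,n}=M^n\oplus Y_2^n$, $R_{T,n}=N^n\oplus X_2^n$, $R_{\tilde S,n}=\mathbb M^n\oplus\mathbb Y_2^n$, $R_{\tilde T,n}=\mathbb N^n\oplus\mathbb X_2^n$, $R_{S,n}=R_{S,n+1}\oplus R_{\tilde S,n}$, $R_{T,n}=R_{T,n+1}\oplus R_{\tilde T,n}$. *)

(* Defs.v *)
From HB Require Import structures.
From mathcomp Require Import all_boot all_order all_algebra.
From mathcomp Require Import complex.
From mathcomp Require Import boolp classical_sets functions cardinality reals.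
From mathcomp Require Import topology normedtype.

Set Implicit Arguments.
Unset Strict Implicit.
Unset Printing Implicit Defensive.

Import Order.TTheory GRing.Theory Num.Theory.
Import numFieldNormedType.Exports.

Local Open Scope classical_set_scope.
Local Open Scope ring_scope.

(* Banach spaces may be real or complex: the scalars are R or R[i]. *)
Inductive scalar_kind := RealScalars | ComplexScalars.

Definition scalar_field (R : realType) (k : scalar_kind) : numFieldType :=
  match k with
  | RealScalars => R
  | ComplexScalars => R[i]
  end.

Section LinearAlgebra.
Context {K : numFieldType}.
Implicit Types U V : lmodType K.

Definition is_subspace V (A : set V) : Prop := submod_closed (mem A).

(* A / B is finite dimensional, i.e. spanned by finitely many classes modulo
   B of vectors of A; only used with B a subspace of A. *)
Definition fin_dim_quotient V (A B : set V) : Prop :=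
  exists (n : nat) (e : 'I_n -> V), (forall i, A (e i)) /\
    forall a, A a -> exists c : 'I_n -> K, B (a - \sum_(i < n) c i *: e i).

Definition fin_dim V (A : set V) : Prop := fin_dim_quotient A [set 0].

Definition null_space U V (f : {linear U -> V}) : set U := [set u | f u = 0].

Definition summands V (Fs : seq (set V)) : set {ffun 'I_(size Fs) -> V} :=
  [set v | forall i : 'I_(size Fs), nth set0 Fs i (v i)].
Arguments summands [V] Fs _.

Definition ffsum V n (v : {ffun 'I_n -> V}) : V := \sum_(i < n) v i.

Definition sum_space V (Fs : seq (set V)) : set V := @ffsum V _ @` summands Fs.

(* W is the internal direct sum of the list Fs: every element of W is in a
   unique way a sum of elements of the members of Fs, and all these sums are
   in W. *)
Definition direct_sum V (W : set V) (Fs : seq (set V)) : Prop :=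
  set_bij (summands Fs) W (@ffsum V _).

(* From A in U and B in V: B, f(A), f(g(B)), f(g(f(A))), and so on. *)
Fixpoint alt_image n U V (f : U -> V) (g : V -> U) (A : set U) (B : set V)
    : set V :=
  if n is m.+1 then f @` alt_image m g f B A else B.

Definition stable_from V (F : nat -> set V) (p : nat) : Prop :=
  forall k, F p = F (p + k)%N.

Definition stable_index V (F : nat -> set V) (p : nat) : Prop :=
  [/\ (1 <= p)%N, stable_from F p &
      forall m, (1 <= m)%N -> stable_from F m -> (p <= m)%N].

End LinearAlgebra.

Section Pairs.
Context {K : numFieldType} {X Y : completeNormedModType K}.
Implicit Types (S : {linear X -> Y}) (T : {linear Y -> X}).

(* By linear_boundedP, bounded_near f (nbhs 0) is the existence of an
   operator bound |f u| <= r |u|. *)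
Definition bounded_operator (U V : completeNormedModType K)
    (f : {linear U -> V}) : Prop :=
  bounded_near f (nbhs (0 : U)).

Definition regular_operator (U V : completeNormedModType K)
    (f : {linear U -> V}) : Prop :=
  exists2 f' : {linear V -> U}, bounded_operator f' &
    forall u, f (f' (f u)) = f u.

Definition fredholm_pair S T : Prop :=
  let NS := null_space S in let NT := null_space T in
  [/\ fin_dim_quotient NS (NS `&` range T),
      fin_dim_quotient (range T) (NS `&` range T),
      fin_dim_quotient NT (NT `&` range S) &
      fin_dim_quotient (range S) (NT `&` range S)].

Definition regular_fredholm_pair S T : Prop :=
  [/\ bounded_operator S, bounded_operator T, fredholm_pair S T,
      regular_operator S & regular_operator T].

Definition RS S T n : set Y := alt_image n S T [set: X] [set: Y].
Definition RT S T n : set X := alt_image n T S [set: Y] [set: X].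

Inductive pair_case := CaseI | CaseII | CaseIII.

Definition has_case S T (c : pair_case) (n : nat) : Prop :=
  exists p q, [/\ stable_index (RS S T) p, stable_index (RT S T) q,
    n = minn p q &
    match c with
    | CaseI => p = q
    | CaseII => (p < q)%N
    | CaseIII => (q < p)%N
    end].

Record subspace_system := SubspaceSystem {
  X1 : set X; X2 : set X; Xt : set X;
  Y1 : set Y; Y2 : set Y; Yt : set Y }.
Implicit Types D : subspace_system.

Definition decomposition_system S T D : Prop :=
  let NS := null_space S in let NT := null_space T in
  [/\ [/\ is_subspace (X1 D), is_subspace (X2 D), is_subspace (Y1 D) &
          is_subspace (Y2 D)],
      [/\ fin_dim (X1 D), fin_dim (X2 D), fin_dim (Y1 D) & fin_dim (Y2 D)],
      [/\ is_subspace (Xt D), closed (Xt D), is_subspace (Yt D) & closed (Yt D)],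
      [/\ direct_sum NS [:: NS `&` range T; X1 D],
          direct_sum (range T) [:: NS `&` range T; X2 D] &
          direct_sum [set: X] [:: NS `&` range T; X1 D; X2 D; Xt D]] &
      [/\ direct_sum NT [:: NT `&` range S; Y1 D],
          direct_sum (range S) [:: NT `&` range S; Y2 D] &
          direct_sum [set: Y] [:: NT `&` range S; Y1 D; Y2 D; Yt D]]].

Definition Mn S T n : set Y := RS S T n `&` null_space T.
Definition Nn S T n : set X := RT S T n `&` null_space S.
Definition Y2n S T D n : set Y := RS S T n `&` Y2 D.
Definition X2n S T D n : set X := RT S T n `&` X2 D.

(* The suffix t stands for the tilde; only the indices n >= 1 are used. *)
Definition RSt S T D n : set Y := alt_image n S T (Xt D) (Yt D).
Definition RTt S T D n : set X := alt_image n T S (Yt D) (Xt D).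

(* Doubled letters stand for blackboard bold. *)
Definition MM S T D n : set Y := RSt S T D n `&` null_space T.
Definition NN S T D n : set X := RTt S T D n `&` null_space S.
Definition YY2 S T D n : set Y := RSt S T D n `&` Y2n S T D n.
Definition XX2 S T D n : set X := RTt S T D n `&` X2n S T D n.

Definition XtN S T D : set X := Xt D `&` S @^-1` MM S T D 1.
Definition Xt2 S T D : set X := Xt D `&` S @^-1` YY2 S T D 1.
Definition YtN S T D : set Y := Yt D `&` T @^-1` NN S T D 1.
Definition Yt2 S T D : set Y := Yt D `&` T @^-1` XX2 S T D 1.

Definition adapted S T D : Prop :=
  forall n, (1 <= n)%N ->
  [/\ direct_sum (RS S T n) [:: Mn S T n; Y2n S T D n] /\
      direct_sum (RT S T n) [:: Nn S T n; X2n S T D n],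
      direct_sum (RSt S T D n) [:: MM S T D n; YY2 S T D n] /\
      direct_sum (RTt S T D n) [:: NN S T D n; XX2 S T D n],
      direct_sum (RS S T n) [:: RS S T n.+1; RSt S T D n] &
      direct_sum (RT S T n) [:: RT S T n.+1; RTt S T D n]].

(* The restriction of f to A is an isomorphism of Banach spaces onto B. *)
Definition banach_iso (U V : completeNormedModType K) (f : {linear U -> V})
    (A : set U) (B : set V) : Prop :=
  [/\ is_subspace A /\ closed A, is_subspace B /\ closed B,
      {within A, continuous f}, set_bij A B f &
      exists2 g : V -> U, {in A, cancel f g} & {within B, continuous g}].

Definition banach_iso_sum (U V : completeNormedModType K)
    (f : {linear U -> V}) (A : set U) (Bs : seq (set V)) : Prop :=
  exists2 B, direct_sum B Bs & banach_iso f A B.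

End Pairs.

Arguments subspace_system {K} X Y.

(* Main.v *)
Require Import Defs.
From HB Require Import structures.
From mathcomp Require Import all_boot all_order all_algebra.
From mathcomp Require Import complex ring lra.
From mathcomp Require Import boolp classical_sets functions cardinality reals.
From mathcomp Require Import topology normedtype.

Set Implicit Arguments.
Unset Strict Implicit.

Import Order.TTheory GRing.Theory Num.Theory.
Import numFieldNormedType.Exports.
Local Open Scope classical_set_scope.
Local Open Scope ring_scope.

(** Why the theorem holds.  Write [R_n] for [RS S T n] in [Y] and [R'_n] for
    [RT S T n] in [X].

    A complement [Y2] of [N(T) :&: R(S)] in [R(S)] can be built from the bottom
    of the decreasing chain [R_n] upwards, so that [R_n :&: Y2] complements
    [M^n = R_n :&: N(T)] in [R_n] for every [n >= 1] ([adapted_complement]).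
    Then [T] identifies [R_n :&: Y2] with [R'_(n+1)].  The same holds for [S]
    and a complement [X2] of [N(S) :&: R(T)] in [R(T)].

    An adapted system amounts to complements [U_n] of [R_(n+1)] in [R_n] and
    [V_n] of [R'_(n+1)] in [R'_n], each one the sum of its part in the kernel
    and its part in [Y2] or [X2], with [T(U_n) = V_(n+1)] and
    [S(V_n) = U_(n+1)].  The image of a subspace that splits along
    [N(T)] and [Y2] need not split along [N(S)] and [X2], so the choice goes
    backwards: [U_n] and [V_n] are zero once both chains are stationary, and
    [U_n] is the sum of a complement of [M^(n+1)] in [M^n] and of the part of
    [Y2] that [T] maps to [V_(n+1)] ([tilde_step], [exists_tilde_chain]).  When
    [S'] is a bounded generalized inverse of [S], the space that [S] maps
    isomorphically onto [U_1] is the part of [range (S' \o S)] above [U_1],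
    and [S'] is the continuous inverse ([section_space]).

    Finite dimensional subspaces must have closed complements: the complement
    of [M^2] in [M^1] is infinite dimensional in general.  This rests on the
    Hahn-Banach theorem, proved for real and complex scalars together from the
    fact that a minimal sublinear functional is linear ([hahn_banach_seminorm]).
    It provides continuous linear left inverses of injective operators on
    finite dimensional spaces ([lspan_left_inverse]), hence bounded projections
    and the continuity of all finite dimensional inverses.

    Finally, let [R_n] be stationary from [p] on.  The operator [S \o T] maps the
    finite dimensional space [R_p] onto itself, so it is injective there.  Hence
    [M^p] and [N^(p+1)] vanish and [X_2^(p-1) = R'_(p+1)], which [T] and [S]
    exchange with [R_p = Y_2^p].  The decompositions of [X] and [Y] come from
    telescoping [M^n = M^(n+1) + MM^n] and its three analogues, and the
    vanishing of [XX_2^n] for [n >= p - 1] gives the exceptional cases. *)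

(** * The Hahn-Banach theorem for a seminorm *)

Section HahnBanach.
Context {R : realType} {K : nzRingType} (iota : {rmorphism R -> K}).
Context {V : lmodType K}.
Implicit Types (q : V -> R) (x y : V).

(** Homogeneity is over the real scalars, embedded in [K] by [iota]; this lets one
    argument serve real and complex spaces. *)
Definition sublinear q : Prop :=
  (forall x y, q (x + y) <= q x + q y) /\
  (forall (a : R) x, 0 <= a -> q (iota a *: x) <= a * q x).

Lemma sublinear_ge q x : sublinear q -> - q (- x) <= q x.
Proof.
move=> [qD qZ]; rewrite lerNl -subr_ge0 opprK.
have q00 : 0 <= q 0 by have := qD 0 0; rewrite addr0; lra.
by apply: le_trans q00 _; rewrite -(subrr x) addrC.
Qed.

(** The two ways of lowering a sublinear functional below, shearing along a
    vector and passing to the infimum of a chain, are instances of this. *)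
Lemma sublinear_inf (I : Type) (D : set I) (F : I -> V -> R) :
    D !=set0 -> (forall x, has_lbound [set F i x | i in D]) ->
    (forall i j x y, D i -> D j ->
      exists2 k, D k & F k (x + y) <= F i x + F j y) ->
    (forall i (a : R) x, D i -> 0 <= a ->
      exists2 k, D k & F k (iota a *: x) <= a * F i x) ->
  sublinear (fun x => inf [set F i x | i in D]).
Proof.
move=> [i0 Di0] Flb FD FZ.
have Fne x : [set F i x | i in D] !=set0 by exists (F i0 x), i0.
have infF i x : D i -> inf [set F i x | i in D] <= F i x.
  by move=> Di; apply: ge_inf => //; exists i.
split=> [x y|a x a0].
  rewrite -lerBlDr; apply: lb_le_inf => // _ [i Di <-].
  rewrite lerBlDr -lerBlDl; apply: lb_le_inf => // _ [j Dj <-].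
  rewrite lerBlDl; have [k Dk] := FD i j x y Di Dj.
  by apply: le_trans; apply: infF.
have [->|a_neq0] := eqVneq a 0.
  have [k Dk] := FZ i0 0 x Di0 (lexx _); rewrite !mul0r.
  by apply: le_trans; apply: infF.
have a_gt0 : 0 < a by rewrite lt_def a_neq0.
rewrite -ler_pdivrMl//; apply: lb_le_inf => // _ [i Di <-].
rewrite ler_pdivrMl//; have [k Dk] := FZ i a x Di a0.
by apply: le_trans; apply: infF.
Qed.

(** The largest sublinear functional below [q] whose value at [- y] is at
    most [- q y]. *)
Definition shear q y x : R :=
  inf [set q (x + iota t *: y) - t * q y | t in [set t | 0 <= t]].

Lemma sublinearZ_ge q (a : R) x : sublinear q -> 0 <= a ->
  a * q x <= q (iota a *: x).
Proof.
move=> [qD qZ]; rewrite le_eqVlt => /predU1P[<-|a_gt0].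
  by rewrite mul0r rmorph0 scale0r; have := qD 0 0; rewrite addr0; lra.
rewrite -ler_pdivlMl//; apply: le_trans (qZ a^-1 _ _); last first.
  by rewrite invr_ge0 ltW.
by rewrite scalerA -rmorphM mulVf ?gt_eqF// rmorph1 scale1r.
Qed.

Lemma shear_lb q y x : sublinear q ->
  has_lbound [set q (x + iota t *: y) - t * q y | t in [set t | 0 <= t]].
Proof.
move=> sq; exists (- q (- x)) => _ [t /= t0 <-].
have [qD qZ] := sq; have := sublinearZ_ge y sq t0.
by have := qD (- x) (x + iota t *: y); rewrite addKr; lra.
Qed.

Lemma shear_le q y x t : sublinear q -> 0 <= t ->
  shear q y x <= q (x + iota t *: y) - t * q y.
Proof. by move=> sq t0; apply: ge_inf; [exact: shear_lb|exists t]. Qed.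

Lemma sublinear_shear q y : sublinear q -> sublinear (shear q y).
Proof.
move=> sq; have [qD qZ] := sq.
apply: (@sublinear_inf R [set t | 0 <= t]
  (fun t x => q (x + iota t *: y) - t * q y)).
- by exists 0 => /=.
- by move=> x; exact: shear_lb.
- move=> s t x z /= s0 t0; exists (s + t); first exact: addr_ge0.
  have := qD (x + iota s *: y) (z + iota t *: y).
  by rewrite addrACA -scalerDl -rmorphD; lra.
- move=> t a x /= t0 a0; exists (a * t); first exact: mulr_ge0.
  have := qZ a (x + iota t *: y) a0.
  by rewrite scalerDr scalerA -rmorphM mulrBr mulrA; lra.
Qed.

(** By minimality no shear lowers [q], so [q x <= q (x + y) - q y], which is
    superadditivity. *)
Lemma minimal_sublinear_additive q : sublinear q ->
    (forall q', sublinear q' -> (forall x, q' x <= q x) -> q' = q) ->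
  forall x y, q (x + y) = q x + q y.
Proof.
move=> sq qmin x y; have [qD _] := sq; apply/eqP; rewrite eq_le qD /=.
have eq_q : shear q y = q.
  apply: qmin; first exact: sublinear_shear.
  move=> z; have := shear_le y z sq (lexx _).
  by rewrite rmorph0 scale0r addr0 mul0r subr0.
have := shear_le y x sq ler01.
by rewrite eq_q rmorph1 scale1r mul1r; lra.
Qed.

(** The bound [q x >= - q0 (- x)] keeps the pointwise infimum of a chain
    finite, so Zorn's lemma applies downwards. *)
Lemma exists_minimal_sublinear q0 : sublinear q0 ->
  exists q, [/\ sublinear q, forall x, q x <= q0 x &
    forall q', sublinear q' -> (forall x, q' x <= q x) -> q' = q].
Proof.
move=> sq0.
pose T := {q : V -> R | sublinear q /\ forall x, q x <= q0 x}.
pose ge_fun (q q' : T) := `[< forall x, sval q' x <= sval q x >].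
have [|||A totA|q qmax] := @Zorn T ge_fun.
- by move=> q; apply/asboolP.
- move=> q q' q'' /asboolP le1 /asboolP le2; apply/asboolP => x.
  exact: le_trans (le2 x) (le1 x).
- move=> q q' /asboolP le1 /asboolP le2.
  case: q q' le1 le2 => [q sq] [q' sq'] /= le1 le2; apply: eq_exist.
  by apply/funext => x; apply/eqP; rewrite eq_le le1 le2.
- have [[q1 Aq1]|A0] := pselect (A !=set0); last first.
    exists (exist _ q0 (conj sq0 (fun x => lexx (q0 x)))) => q Aq.
    by case: A0; exists q.
  have lb x : has_lbound [set sval q x | q in A].
    exists (- q0 (- x)) => _ [q Aq <-]; have [sq leq] := svalP q.
    by apply: le_trans (sublinear_ge _ sq); rewrite lerN2.
  have sinf : sublinear (fun x => inf [set sval q x | q in A]).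
    apply: sublinear_inf => //; first by exists q1.
      move=> q q' x y Aq Aq'.
      have [/asboolP le|/asboolP le] := totA q q' Aq Aq'.
        exists q' => //; have [[qD _] _] := svalP q'.
        by apply: le_trans (qD x y) _; rewrite lerD2r.
      exists q => //; have [[qD _] _] := svalP q.
      by apply: le_trans (qD x y) _; rewrite lerD2l.
    move=> q a x Aq a0; exists q => //; have [[_ qZ] _] := svalP q.
    exact: qZ.
  have infle (q : T) x : A q -> inf [set sval q x | q in A] <= sval q x.
    by move=> Aq; apply: ge_inf; [exact: lb|exists q].
  have infle0 x : inf [set sval q x | q in A] <= q0 x.
    exact: le_trans (infle _ _ Aq1) ((svalP q1).2 x).
  exists (exist (fun q => sublinear q /\ forall x, q x <= q0 x) _
    (conj sinf infle0)) => q Aq; apply/asboolP => x /=.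
  exact: infle.
exists (sval q); have [sq leq] := svalP q; split=> // q' sq' le_q'q.
have le_q'0 x : q' x <= q0 x by apply: le_trans (le_q'q x) (leq x).
pose t' : T := exist _ q' (conj sq' le_q'0).
by have <- : t' = q by apply: qmax; apply/asboolP.
Qed.

(** A minimal functional below the shear of [N] along [v] is linear and at
    least [N v] at [v], because it is at most [- N v] at [- v]. *)
Lemma hahn_banach_seminorm (N : V -> R) (v : V) :
    (forall x y, N (x + y) <= N x + N y) ->
    (forall a x, N (iota a *: x) = `|a| * N x) ->
  exists u : V -> R, [/\ forall x y, u (x + y) = u x + u y,
    forall a x, u (iota a *: x) = a * u x, forall x, u x <= N x & u v = N v].
Proof.
move=> ND NZ.
have sN : sublinear N by split=> // a x a0; rewrite NZ ger0_norm.
have [u [su leu umin]] := exists_minimal_sublinear (sublinear_shear v sN).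
have uD := minimal_sublinear_additive su umin.
have leuN x : u x <= N x.
  apply: le_trans (leu x) _; have := shear_le v x sN (lexx _).
  by rewrite rmorph0 scale0r addr0 mul0r subr0.
have uN x : u (- x) = - u x.
  have u0 : u 0 = 0 by apply: (@addrI _ (u 0)); rewrite -uD !addr0.
  by apply/eqP; rewrite -addr_eq0 -uD addNr u0.
exists u; split=> //; last first.
  apply/eqP; rewrite eq_le leuN /=.
  have := leu (- v); have := shear_le v (- v) sN ler01.
  have : N 0 = 0 by rewrite -(scale0r 0) -(rmorph0 iota) NZ normr0 mul0r.
  rewrite uN rmorph1 scale1r addNr; lra.
have [_ uZ] := su.
have uZ_ge0 a x : 0 <= a -> u (iota a *: x) = a * u x.
  move=> a0; apply/eqP; rewrite eq_le uZ//=.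
  by have := uZ a (- x) a0; rewrite scalerN !uN; lra.
move=> a x; have [a0|/ltW a0] := leP 0 a; first exact: uZ_ge0.
rewrite -[a in LHS]opprK rmorphN scaleNr uN uZ_ge0 ?oppr_ge0//.
by rewrite mulNr opprK.
Qed.

End HahnBanach.

(** * Continuous linear forms on real and complex normed spaces *)

Section ContinuousFunctionals.
Context {K : numFieldType}.

Lemma linear_of_fun (V W : lmodType K) (f : V -> W) :
    (forall a x y, f (a *: x + y) = a *: f x + f y) ->
  exists h : {linear V -> W}, forall x, h x = f x.
Proof.
move=> fl; pose m := GRing.isLinear.Build K V W *:%R f fl.
by pose h : {linear V -> W} := HB.pack f m; exists h.
Qed.

Lemma bounded_by_continuous (V W : normedModType K) (f : {linear V -> W})
    (r : K) :
  r \is Num.real -> (forall x, `|f x| <= r * `|x|) -> continuous f.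
Proof.
move=> r_real fr; apply: bounded_linear_continuous; apply/linear_boundedP.
exists r; split=> // s /ltW r_le_s x; apply: le_trans (fr x) _.
by rewrite ler_wpM2r.
Qed.

(** The only consequence of the Hahn-Banach theorem that is used. *)
Definition enough_functionals : Prop :=
  forall (V : normedModType K) (v : V), v != 0 ->
  exists2 h : {linear V -> K^o}, continuous h & h v = 1.

Lemma functional_normalize (V : normedModType K) (v : V)
    (f : V -> K) (r : K) :
    r \is Num.real -> (forall a x y, f (a *: x + y) = a * f x + f y) ->
    (forall x, `|f x| <= r * `|x|) -> f v != 0 ->
  exists2 h : {linear V -> K^o}, continuous h & h v = 1.
Proof.
move=> r_real fl fr fv0.
have [|h hE] := @linear_of_fun V K^o (fun x => (f v)^-1 * f x).
  by move=> a x y; rewrite fl mulrDr mulrCA.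
exists h; last by rewrite hE mulVf.
apply: (@bounded_by_continuous V K^o h (`|f v|^-1 * r)).
  by rewrite realM// realV normr_real.
by move=> x; rewrite hE normrM normfV -mulrA ler_wpM2l// invr_ge0.
Qed.

End ContinuousFunctionals.

Lemma real_enough_functionals (R : realType) :
  enough_functionals (K := R).
Proof.
move=> V v v0.
have [||u [uD uZ uN uv]] :=
  @hahn_banach_seminorm R R idfun V (fun x => `|x|) v.
- exact: ler_normD.
- by move=> a x; rewrite normrZ.
have u_opp x : u (- x) = - u x by rewrite -scaleN1r uZ mulN1r.
apply: (@functional_normalize R V v u 1) => //.
- by move=> a x y; rewrite uD uZ.
- by move=> x; rewrite mul1r ler_norml uN lerNl -u_opp -[`|x|]normrN uN.
- by rewrite uv normr_eq0.
Qed.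

(** A real-linear [u] dominated by the norm is the real part of the
    complex-linear form [x |-> u x - i * u (i x)]. *)
Lemma complex_enough_functionals (R : realType) :
  enough_functionals (K := R[i]).
Proof.
move=> V v v0; pose N (x : V) := complex.Re `|x|.
have NE x : (N x)%:C%C = `|x| by apply: RRe_real; rewrite normr_real.
have [||u [uD uZ uN uv]] := @hahn_banach_seminorm R R[i] (real_complex R) V N v.
- by move=> x y; rewrite -lecR rmorphD/= !NE ler_normD.
- move=> a x; apply: complexI; rewrite rmorphM/= !NE normrZ; congr (_ * _).
  by rewrite normc_def/= expr0n/= addr0 sqrtr_sqr.
have u_opp x : u (- x) = - u x.
  by rewrite -scaleN1r -(rmorphN1 (real_complex R)) uZ mulN1r.
have u_abs x : `|(u x)%:C%C| <= `|x|.
  rewrite normc_def/= expr0n/= addr0 sqrtr_sqr -NE lecR ler_norml uN.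
  by rewrite lerNl -u_opp (le_trans (uN _))// /N normrN.
pose f x : R[i] := (u x)%:C%C - 'i%C * (u ('i%C *: x))%:C%C.
apply: (@functional_normalize R[i] V v f 2) => //.
- move=> a x y; rewrite /f.
  have uZc z : u (a *: z) = complex.Re a * u z + complex.Im a * u ('i%C *: z).
    by rewrite {1}[a]complexE scalerDl uD uZ ['i%C * _]mulrC -scalerA uZ.
  rewrite scalerDr !uD scalerA ['i%C * a]mulrC -scalerA !uZc.
  rewrite [in RHS](complexE a) scalerA -expr2 sqr_i scaleN1r u_opp.
  rewrite !rmorphD !rmorphM !rmorphN/=.
  have : 'i%C ^+ 2 = -1 :> R[i] by exact: sqr_i.
  move: 'i%C => j jj; ring: jj.
- move=> x; apply: le_trans (ler_normB _ _) _; rewrite mulr_natl mulr2n lerD//.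
  rewrite normrM (le_trans (ler_wpM2l _ (u_abs _)))// normrZ.
  by rewrite complexiE normCi !mul1r.
- apply/negP => /eqP /(congr1 (@complex.Re R)); rewrite /f /= uv; simpc => Nv0.
  by move: v0; rewrite -normr_eq0 -NE Nv0 eqxx.
Qed.

Lemma scalar_field_enough_functionals (R : realType) (k : scalar_kind) :
  enough_functionals (K := scalar_field R k).
Proof.
case: k; [exact: real_enough_functionals|exact: complex_enough_functionals].
Qed.

(** * Subspaces, direct sums and finite dimension *)

Section Subspaces.
Context {K : numFieldType}.
Implicit Types U V : lmodType K.

Lemma subspaceP V (A : set V) :
  is_subspace A <-> A 0 /\ forall a u v, A u -> A v -> A (a *: u + v).
Proof.
rewrite /is_subspace /submod_closed; split.
  move=> [/set_mem A0 Al]; split=> // a u v Au Av.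
  by apply: set_mem; apply: Al; apply: mem_set.
move=> [A0 Al]; split; first exact: mem_set.
by move=> a u v /set_mem Au /set_mem Av; apply: mem_set; apply: Al.
Qed.

Lemma subspace0 V (A : set V) : is_subspace A -> A 0.
Proof. by move=> /subspaceP[]. Qed.

Lemma subspaceD V (A : set V) u v : is_subspace A -> A u -> A v -> A (u + v).
Proof. by move=> /subspaceP[_ Al] Au Av; rewrite -[u]scale1r; apply: Al. Qed.

Lemma subspaceZ V (A : set V) a u : is_subspace A -> A u -> A (a *: u).
Proof. by move=> /subspaceP[A0 Al] Au; rewrite -[_ *: _]addr0; apply: Al. Qed.

Lemma subspaceN V (A : set V) u : is_subspace A -> A u -> A (- u).
Proof. by move=> sA Au; rewrite -scaleN1r; apply: subspaceZ. Qed.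

Lemma subspaceB V (A : set V) u v : is_subspace A -> A u -> A v -> A (u - v).
Proof. by move=> sA Au Av; apply: subspaceD => //; apply: subspaceN. Qed.

Lemma subspace_zero V : is_subspace [set (0 : V)].
Proof. by apply/subspaceP; split=> // a _ _ -> ->; rewrite scaler0 addr0. Qed.

Lemma subspaceT V : is_subspace [set: V].
Proof. exact/subspaceP. Qed.

Lemma subspaceI V (A B : set V) :
  is_subspace A -> is_subspace B -> is_subspace (A `&` B).
Proof.
move=> /subspaceP[A0 Al] /subspaceP[B0 Bl]; apply/subspaceP; split=> //.
by move=> a u v [Au Bu] [Av Bv]; split; [apply: Al|apply: Bl].
Qed.

Lemma subspace_image U V (f : {linear U -> V}) (A : set U) :
  is_subspace A -> is_subspace (f @` A).
Proof.
move=> /subspaceP[A0 Al]; apply/subspaceP; split.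
  by exists 0 => //; rewrite linear0.
move=> a _ _ [u Au <-] [v Av <-]; exists (a *: u + v); first exact: Al.
by rewrite linearP.
Qed.

Lemma subspace_preimage U V (f : {linear U -> V}) (B : set V) :
  is_subspace B -> is_subspace (f @^-1` B).
Proof.
move=> /subspaceP[B0 Bl]; apply/subspaceP; split; first by rewrite /= linear0.
by move=> a u v /= Bu Bv; rewrite linearP; apply: Bl.
Qed.

Lemma subspace_null U V (f : {linear U -> V}) : is_subspace (null_space f).
Proof.
have -> : null_space f = f @^-1` [set 0] by [].
exact/subspace_preimage/subspace_zero.
Qed.

Lemma subspace_sum V (A B : set V) : is_subspace A -> is_subspace B ->
  is_subspace [set a + b | a in A & b in B].
Proof.
move=> sA sB; apply/subspaceP; split.
  by exists 0; [exact: subspace0|exists 0; [exact: subspace0|rewrite addr0]].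
move=> k _ _ [a Aa [b Bb <-]] [a' Aa' [b' Bb' <-]].
exists (k *: a + a'); first by apply: subspaceD => //; apply: subspaceZ.
exists (k *: b + b'); first by apply: subspaceD => //; apply: subspaceZ.
by rewrite scalerDr addrACA.
Qed.

(** [W] is the internal direct sum of the subspaces [A] and [B].  This binary form
    is easier to compose than [direct_sum]. *)
Record splitting V (W A B : set V) : Prop := Splitting {
  splitting_l : is_subspace A;
  splitting_r : is_subspace B;
  splitting_subl : A `<=` W;
  splitting_subr : B `<=` W;
  splitting_whole : is_subspace W;
  splitting_cover : forall w, W w -> exists a b, [/\ A a, B b & w = a + b];
  splitting_trivial : forall x, A x -> B x -> x = 0 }.

Lemma splittingC V (W A B : set V) : splitting W A B -> splitting W B A.
Proof.
case=> sA sB AW BW sW cov tr; split=> //; last by move=> x Bx Ax; exact: tr.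
by move=> w /cov[a [b [Aa Bb ->]]]; exists b, a; split=> //; rewrite addrC.
Qed.

(** Associativity is what lets splittings be concatenated and telescoped. *)
Lemma splitting_assoc V (W A B C D : set V) :
    splitting W A B -> splitting A C D ->
  exists2 E, splitting W C E & splitting E D B.
Proof.
case=> sA sB AW BW sW covW trW [sC sD CA DA _ covA trA].
have sE := subspace_sum sD sB.
exists [set d + b | d in D & b in B]; split=> //.
- by move=> c /CA /AW.
- move=> _ [d Dd [b Bb <-]]; apply: subspaceD => //; last exact: BW.
  exact/AW/DA.
- move=> w /covW[a [b [Aa Bb ->]]]; have [c [d [Cc Dd ->]]] := covA _ Aa.
  by exists c, (d + b); split; [|exists d => //; exists b|rewrite addrA].
- move=> x Cx [d Dd [b Bb dbE]].
  have b0 : b = 0.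
    apply: trW => //; rewrite -[b](addKr d) dbE.
    by apply: subspaceD => //; [apply: subspaceN => //; exact: DA|exact: CA].
  by move: dbE Cx; rewrite b0 addr0 => <- Cd; apply: trA.
- by move=> d Dd; exists d => //; exists 0; [exact: subspace0|rewrite addr0].
- by move=> b Bb; exists 0; [exact: subspace0|exists b => //; rewrite add0r].
- by move=> _ [d Dd [b Bb <-]]; exists d, b.
- by move=> x Dx Bx; apply: trW => //; exact: DA.
Qed.

Lemma splitting0l V (W B : set V) : splitting W [set 0] B -> W = B.
Proof.
move=> [_ _ _ BW _ cov _]; apply/seteqP; split=> // w /cov[_ [b [-> Bb ->]]].
by rewrite add0r.
Qed.

Lemma splitting_zero V (W : set V) : is_subspace W -> splitting W W [set 0].
Proof.
move=> sW; split=> //; first exact: subspace_zero.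
  by move=> _ ->; exact: subspace0.
by move=> w Ww; exists w, 0; rewrite addr0.
Qed.

(** Internal direct sums of lists, nested to the right. *)
Fixpoint splitting_seq V (W : set V) (Fs : seq (set V)) : Prop :=
  if Fs is A :: Gs then exists2 B, splitting W A B & splitting_seq B Gs
  else W = [set 0].

Lemma splitting_seq1 V (W : set V) : is_subspace W -> splitting_seq W [:: W].
Proof. by move=> sW; exists [set 0] => //; exact: splitting_zero. Qed.

Lemma splitting_seq2 V (W A B : set V) :
  splitting W A B -> splitting_seq W [:: A; B].
Proof.
move=> sW; exists B => //; apply: splitting_seq1; exact: splitting_r sW.
Qed.

Lemma splitting_seq_cat V (W A B : set V) Fs Gs : splitting W A B ->
  splitting_seq A Fs -> splitting_seq B Gs -> splitting_seq W (Fs ++ Gs).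
Proof.
elim: Fs W A => [|C Fs IH] W A sW /=.
  by move=> A0; rewrite {A}A0 in sW; rewrite (splitting0l sW).
move=> [D sA sD] sB; have [E sWE sE] := splitting_assoc sW sA.
by exists E => //; exact: IH sE sD sB.
Qed.

Lemma splitting_seq_direct_sum V (W : set V) Fs :
  splitting_seq W Fs -> direct_sum W Fs.
Proof.
elim: Fs W => [|A Fs IH] W /=.
  move=> ->; split.
  - by move=> v _ /=; rewrite /ffsum big_ord0.
  - by move=> v w _ _ _; apply/ffunP => -[].
  - move=> _ ->; exists [ffun=> 0]; first by case.
    by rewrite /ffsum big_ord0.
move=> [B [sA sB AW BW sW cov tr] /IH[funB injB surB]].
pose tl (v : {ffun 'I_(size (A :: Fs)) -> V}) : {ffun 'I_(size Fs) -> V} :=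
  [ffun i => v (lift ord0 i)].
have ffsum_tl v : ffsum v = v ord0 + ffsum (tl v).
  rewrite /ffsum big_ord_recl; congr (_ + _).
  by apply: eq_bigr => i _; rewrite ffunE.
have summands_tl v : summands v -> summands (tl v).
  by move=> sv i; rewrite ffunE; exact: (sv (lift ord0 i)).
split.
- move=> v sv; rewrite ffsum_tl; apply: subspaceD => //.
    by apply: AW; exact: (sv ord0).
  by apply: BW; apply: funB; exact: summands_tl.
- move=> v w /set_mem sv /set_mem sw; rewrite !ffsum_tl => eq_vw.
  have eq0 : v ord0 = w ord0.
    apply/eqP; rewrite -subr_eq0; apply/eqP; apply: tr.
      by apply: subspaceB => //; [exact: (sv ord0)|exact: (sw ord0)].
    have -> : v ord0 - w ord0 = ffsum (tl w) - ffsum (tl v).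
      by apply/eqP; rewrite subr_eq addrAC eq_sym subr_eq eq_vw addrC.
    by apply: subspaceB => //; apply: funB; exact: summands_tl.
  have : tl v = tl w.
    apply: injB; [exact/mem_set/summands_tl|exact/mem_set/summands_tl|].
    by move: eq_vw; rewrite eq0 => /addrI.
  move=> /ffunP eq_tl; apply/ffunP => i.
  case: (unliftP ord0 i) => [j ->|-> //].
  by have := eq_tl j; rewrite !ffunE.
- move=> w /cov[a [b [Aa /surB[v sv <-] ->]]].
  exists [ffun i => if unlift ord0 i is Some j then v j else a].
    move=> i; rewrite ffunE; case: unliftP => [j ->|-> //]; exact: sv.
  rewrite ffsum_tl ffunE unlift_none; congr (a + ffsum _).
  by apply/ffunP => i; rewrite !ffunE liftK.
Qed.

Lemma splitting_direct_sum V (W A B : set V) :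
  splitting W A B -> direct_sum W [:: A; B].
Proof. by move=> /splitting_seq2/splitting_seq_direct_sum. Qed.

Lemma sum_space_null U V (f : {linear U -> V}) (Fs : seq (set U)) u :
  (forall i, (i < size Fs)%N -> nth set0 Fs i `<=` null_space f) ->
  sum_space Fs u -> f u = 0.
Proof.
move=> Fs0 [v sv <-]; rewrite /ffsum linear_sum big1// => i _.
exact: (Fs0 i (ltn_ord i) _ (sv i)).
Qed.

(** Linear spans by recursion on the generators, which turns all the dimension
    arguments below into inductions on a list. *)
Fixpoint lspan V (s : seq V) : set V :=
  if s is e :: s' then [set x | exists a, lspan s' (x - a *: e)] else [set 0].

Lemma subspace_lspan V (s : seq V) : is_subspace (lspan s).
Proof.
elim: s => [|e s IH]; first exact: subspace_zero.
apply/subspaceP; split.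
  by exists 0; rewrite scale0r subr0; exact: subspace0.
move=> k u v [a sa] [b sb]; exists (k * a + b).
have -> : k *: u + v - (k * a + b) *: e = k *: (u - a *: e) + (v - b *: e).
  by rewrite scalerBr scalerDl scalerA opprD addrACA.
by apply: subspaceD => //; apply: subspaceZ.
Qed.

Lemma lspan_head V (e : V) s : lspan (e :: s) e.
Proof.
by exists 1; rewrite scale1r subrr; exact: (subspace0 (subspace_lspan s)).
Qed.

Lemma lspan_tail V (e : V) s : lspan s `<=` lspan (e :: s).
Proof. by move=> x sx; exists 0; rewrite scale0r subr0. Qed.

Lemma lspan_sub V (s : seq V) (A : set V) :
  is_subspace A -> (forall e, e \in s -> A e) -> lspan s `<=` A.
Proof.
move=> sA; elim: s => [_ _ ->|e s IH As x [a sx]]; first exact: subspace0.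
rewrite -[x](subrK (a *: e)); apply: subspaceD => //; last first.
  by apply: subspaceZ => //; apply: As; rewrite mem_head.
by apply: IH sx => y ys; apply: As; rewrite inE ys orbT.
Qed.

Lemma lspan_mem V (s : seq V) e : e \in s -> lspan s e.
Proof.
elim: s => // x s IH; rewrite inE => /predU1P[->|/IH]; first exact: lspan_head.
exact: lspan_tail.
Qed.

Lemma lspan_image U V (f : {linear U -> V}) s :
  f @` lspan s = lspan (map f s).
Proof.
apply/seteqP; split.
  move=> _ [x sx <-]; have : lspan s `<=` f @^-1` lspan (map f s).
    apply: lspan_sub; first exact/subspace_preimage/subspace_lspan.
    by move=> e es; apply: lspan_mem; exact: map_f.
  exact.
apply: lspan_sub; first exact/subspace_image/subspace_lspan.
by move=> _ /mapP[e es ->]; exists e => //; exact: lspan_mem.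
Qed.

Lemma lspan_coord V (s : seq V) x : lspan s x ->
  exists c : 'I_(size s) -> K, x = \sum_(i < size s) c i *: s`_i.
Proof.
elim: s x => [_ ->|e s IH x [a /IH[c xE]]].
  by exists (fun=> 0); rewrite big_ord0.
exists (fun i => if unlift ord0 i is Some j then c j else a).
rewrite big_ord_recl unlift_none /= -[LHS](subrK (a *: e)) xE addrC.
by congr (_ + _); apply: eq_bigr => i _; rewrite liftK.
Qed.

Definition findim V (A : set V) : Prop := exists s, A = lspan s.

Lemma findim_subspace V (A : set V) : findim A -> is_subspace A.
Proof. by move=> [s ->]; exact: subspace_lspan. Qed.

Lemma findim_fin_dim V (A : set V) : findim A -> fin_dim A.
Proof.
move=> [s ->]; exists (size s), (fun i => s`_i); split.
  by move=> i; apply: lspan_mem; exact: mem_nth.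
by move=> x /lspan_coord[c ->]; exists c; rewrite /= subrr.
Qed.

Lemma fin_dim_quotient_lspan V (A B : set V) : fin_dim_quotient A B ->
  exists s, forall x, A x -> exists2 y, lspan s y & B (x - y).
Proof.
move=> [n [e [_ cov]]]; exists (map e (enum 'I_n)) => x /cov[c Bx].
exists (\sum_(i < n) c i *: e i) => //.
have ss := subspace_lspan (map e (enum 'I_n)).
elim/big_ind: _ => [|y z sy sz|i _]; [exact: subspace0|exact: subspaceD|].
by apply: subspaceZ => //; apply: lspan_mem; apply: map_f; rewrite mem_enum.
Qed.

(** Induction on the generators: the vectors of [A] that need only the tail of
    the list modulo [B] form a subspace [A'], and when [A'] is not [A] it has
    codimension one in [A]. *)
Lemma exists_complement V (A B : set V) (s : seq V) :
    is_subspace A -> is_subspace B ->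
    (forall x, A x -> exists2 y, lspan s y & B (x - y)) ->
  exists2 F, findim F & splitting A (A `&` B) F.
Proof.
move=> sA sB covA; suff [t [tA tB cov]] : exists t, [/\ lspan t `<=` A,
    forall x, lspan t x -> B x -> x = 0 &
    forall x, A x -> exists2 y, lspan t y & B (x - y)].
  have st := subspace_lspan t.
  exists (lspan t); first by exists t.
  split=> //; first exact: subspaceI.
  - move=> x Ax; have [y ty Bxy] := cov x Ax; exists (x - y), y.
    rewrite subrK; split=> //; split=> //.
    by apply: subspaceB => //; exact: tA.
  - by move=> x [_ Bx] tx; exact: tB.
elim: s A sA covA => [|e s IH] A sA covA.
  exists [::]; split=> // _ ->; exact: subspace0.
pose A' := A `&` [set x | exists2 y, lspan s y & B (x - y)].
have sA' : is_subspace A'.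
  apply: subspaceI => //.
  have ss := subspace_lspan s.
  apply/subspaceP; split.
    by exists 0; [exact: subspace0|rewrite subr0; exact: subspace0].
  move=> k u v [y sy Bu] [z sz Bv]; exists (k *: y + z).
    by apply: subspaceD => //; apply: subspaceZ.
  rewrite opprD addrACA -scalerBr; apply: subspaceD => //; exact: subspaceZ.
have [t [tA' tB cov]] := IH A' sA' (fun x A'x => A'x.2).
(* Either the first generator is superfluous, or a single vector [a] of [A]
   outside [A'] supplies the missing dimension. *)
have [AA'|] := pselect (A `<=` A').
  by exists t; split=> // [x /tA'[]//|x /AA'/cov].
move=> /existsNP[a /not_implyP[Aa nA'a]].
have [y [c sy] Bay] := covA a Aa.
have c0 : c != 0.
  apply/eqP => c0; apply: nA'a; split=> //; exists y => //.
  by move: sy; rewrite c0 scale0r subr0.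
have st := subspace_lspan t.
exists (a :: t); split.
- move=> x [k kx]; rewrite -[x](subrK (k *: a)).
  by apply: subspaceD => //; [case: (tA' _ kx)|exact: subspaceZ].
- move=> x [k kx] Bx; have [k0|k0] := eqVneq k 0.
    by apply: tB => //; move: kx; rewrite k0 scale0r subr0.
  exfalso; apply: nA'a; split=> //; have [_ [z sz Bz]] := tA' _ kx.
  exists (- (k^-1 *: z)).
    have ss := subspace_lspan s.
    by apply: subspaceN => //; exact: subspaceZ.
  rewrite opprK.
  have -> : a + k^-1 *: z = k^-1 *: (x - (x - k *: a - z)).
    have -> : x - (x - k *: a - z) = k *: a + z.
      by rewrite -addrA -opprD opprB addrC subrK.
    by rewrite scalerDr scalerA mulVf// scale1r.
  by apply: subspaceZ => //; exact: subspaceB.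
- move=> x Ax; have [z [d sz] Bxz] := covA x Ax.
  (* This multiple of [a] cancels the coefficient of [e]. *)
  have [|w tw Bw] := cov (x - (d / c) *: a).
    split; first by apply: subspaceB => //; exact: subspaceZ.
    exists ((z - d *: e) - (d / c) *: (y - c *: e)).
      have ss := subspace_lspan s.
      by apply: subspaceB => //; exact: subspaceZ.
    have -> : z - d *: e - (d / c) *: (y - c *: e) = z - (d / c) *: y.
      by rewrite scalerBr scalerA divfK// opprB addrA subrK.
    have -> : x - (d / c) *: a - (z - (d / c) *: y) = x - z - (d / c) *: (a - y).
      by rewrite scalerBr !opprB addrACA [RHS]addrACA [- z + _]addrC.
    by apply: subspaceB => //; exact: subspaceZ.
  exists ((d / c) *: a + w).
    by exists (d / c); rewrite addrC addKr.
  by rewrite opprD addrA.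
Qed.

Lemma findim_sub V (A B : set V) :
  is_subspace A -> A `<=` B -> findim B -> findim A.
Proof.
move=> sA AB [s Bs].
have [|F fF [sF _ _ FA _ cov tr]] :=
  @exists_complement V A [set 0] s sA (subspace_zero V).
  by move=> x /AB; rewrite Bs => sx; exists x => //; rewrite subrr.
suff -> : A = F by [].
apply/seteqP; split=> // x /cov[a [b [[_ ->] Fb ->]]]; by rewrite add0r.
Qed.

Lemma lspan_cat V (s t : seq V) :
  [set a + b | a in lspan s & b in lspan t] = lspan (s ++ t).
Proof.
apply/seteqP; split.
  move=> _ [a sa [b tb <-]]; apply: subspaceD; first exact: subspace_lspan.
    apply: lspan_sub sa; first exact: subspace_lspan.
    by move=> e es; apply: lspan_mem; rewrite mem_cat es.
  apply: lspan_sub tb; first exact: subspace_lspan.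
  by move=> e et; apply: lspan_mem; rewrite mem_cat et orbT.
apply: lspan_sub; first by apply: subspace_sum; exact: subspace_lspan.
move=> e; rewrite mem_cat => /orP[es|et].
  exists e; first exact: lspan_mem.
  by exists 0; [exact: (subspace0 (subspace_lspan t))|rewrite addr0].
exists 0; first exact: (subspace0 (subspace_lspan s)).
by exists e; [exact: lspan_mem|rewrite add0r].
Qed.

Lemma findim_sum V (A B : set V) :
  findim A -> findim B -> findim [set a + b | a in A & b in B].
Proof. by move=> [s ->] [t ->]; exists (s ++ t); exact: lspan_cat. Qed.

Lemma findim_image U V (f : {linear U -> V}) A : findim A -> findim (f @` A).
Proof. by move=> [s ->]; exists (map f s); exact: lspan_image. Qed.

(** A linear relation among the images makes one generator redundant. *)
Lemma lspan_image_drop U V (f : {linear U -> V}) (s : seq U) v :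
    lspan s v -> f v = 0 -> v != 0 ->
  exists2 t, (size t < size s)%N & f @` lspan s `<=` lspan t.
Proof.
elim: s => [->|e s IH [a sv] fv v0]; first by rewrite eqxx.
have [a0|a0] := eqVneq a 0.
  have sv' : lspan s v by move: sv; rewrite a0 scale0r subr0.
  have [t szt st] := IH sv' fv v0; exists (f e :: t) => // _ [x [b bx] <-].
  by exists b; apply: st; exists (x - b *: e) => //; rewrite linearB linearZ.
exists (map f s); first by rewrite size_map.
rewrite lspan_image; apply: lspan_sub; first exact: subspace_lspan.
have sub1 x : lspan s x -> lspan (map f s) (f x).
  by move=> sx; rewrite -lspan_image; exists x.
move=> y; rewrite inE => /predU1P[->|]; last exact: lspan_mem.
have -> : f e = - a^-1 *: f (v - a *: e).
  rewrite linearB linearZ fv sub0r scaleNr scalerN opprK scalerA mulVf//.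
  by rewrite scale1r.
by apply: subspaceZ; [exact: subspace_lspan|exact: sub1].
Qed.

(** Otherwise every spanning list of [F] could be shortened. *)
Lemma findim_surjective_injective V (f : {linear V -> V}) (F : set V) v :
  findim F -> F `<=` f @` F -> F v -> f v = 0 -> v = 0.
Proof.
move=> fF surF Fv fv; apply/eqP/negPn/negP => v0.
have [s Fs] : exists s, F `<=` lspan s by case: fF => s ->; exists s.
have [n] := ubnP (size s); elim: n s Fs => // n IH s Fs ltsn.
have [t ltts st] := lspan_image_drop (Fs v Fv) fv v0.
apply: (IH t); last exact: leq_trans ltts ltsn.
move=> x /surF[y Fy <-]; apply: st; exists y => //; exact: Fs.
Qed.

End Subspaces.

(** * Continuous operators and finite dimensional subspaces *)

Section ContinuousMaps.
Context {K : numFieldType}.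
Implicit Types U V W : normedModType K.

Lemma continuous_closed_preimage U V (f : U -> V) (A : set V) :
  continuous f -> closed A -> closed (f @^-1` A).
Proof. by move=> /continuous_closedP; apply. Qed.

Lemma closed_zero V : closed [set (0 : V)].
Proof. exact/accessible_closed_set1/hausdorff_accessible/norm_hausdorff. Qed.

Lemma closed_null_space U V (f : {linear U -> V}) :
  continuous f -> closed (null_space f).
Proof. by move=> cf; exact: (continuous_closed_preimage cf (@closed_zero V)). Qed.

Lemma continuous_fun_comp U V W (f : U -> V) (g : V -> W) :
  continuous f -> continuous g -> continuous (fun x => g (f x)).
Proof. by move=> cf cg x; apply: continuous_comp; [exact: cf|exact: cg]. Qed.

Lemma continuous_funB U V (f g : U -> V) :
  continuous f -> continuous g -> continuous (fun x => f x - g x).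
Proof. by move=> cf cg x; apply: cvgB; [exact: cf|exact: cg]. Qed.

Lemma closed_fixed V (f : V -> V) : continuous f -> closed [set x | f x = x].
Proof.
move=> cf; have -> : [set x | f x = x] = (fun x => f x - x) @^-1` [set 0].
  apply/seteqP; split=> x /= => [->|/eqP]; first by rewrite subrr.
  by rewrite subr_eq0 => /eqP.
apply: continuous_closed_preimage (@closed_zero V); apply: continuous_funB => //.
by move=> x; exact: cvg_id.
Qed.

End ContinuousMaps.

Section FiniteDimension.
Context {K : numFieldType} (functionals : enough_functionals (K := K)).
Implicit Types U V : normedModType K.

(** Generators are added one at a time.  If [g] inverts [f] on the span of [s],
    then [e] may be replaced by [d = e - g (f e)], for which [g (f d) = 0]; a
    continuous form [h] with [h (f d) = 1] is made to vanish on the image of the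
    span by composing it with [y |-> y - f (g y)], and then [g + h _ *: d] is
    the new inverse. *)
Lemma lspan_left_inverse U V (f : {linear U -> V}) (s : seq U) :
    continuous f -> (forall x, lspan s x -> f x = 0 -> x = 0) ->
  exists2 g : {linear V -> U}, continuous g &
    (forall y, lspan s (g y)) /\ (forall x, lspan s x -> g (f x) = x).
Proof.
move=> cf; elim: s => [_|e s IH finj].
  have [|g gE] := @linear_of_fun K V U (fun=> 0).
    by move=> a x y; rewrite scaler0 addr0.
  have {}gE : (g : V -> U) = fun=> 0 by exact: funext.
  by exists g; [rewrite gE => x; exact: cvg_cst|rewrite gE; split=> // x ->].
have [x sx|g cg [rg gK]] := IH; first exact/finj/lspan_tail.
have ss := subspace_lspan s.
pose d := e - g (f e).
have [d0|d0] := eqVneq d 0.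
  exists g => //; split=> [y|x [a sx]]; first exact: lspan_tail.
  have ge : g (f e) = e by apply/eqP; rewrite eq_sym -subr_eq0; exact/eqP.
  by have := gK _ sx; rewrite !linearB !linearZ/= ge => /addIr.
have sd : lspan (e :: s) d.
  by exists 1; rewrite scale1r /d addrC addKr; exact: subspaceN.
have fd0 : f d != 0 by apply: contra_neq d0; exact: finj.
have [h ch hd] := functionals fd0.
have [|g' g'E] := @linear_of_fun K V U (fun y => g y + h (y - f (g y)) *: d).
  move=> a x y; rewrite (linearP g) (linearP f).
  have -> : a *: x + y - (a *: f (g x) + f (g y)) =
      a *: (x - f (g x)) + (y - f (g y)).
    by rewrite opprD addrACA -scalerBr.
  by rewrite (linearP h) scalerDl -scalerA addrACA -scalerDr.
have g'fun : (g' : V -> U) = fun y => g y + h (y - f (g y)) *: d.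
  exact: funext.
exists g'.
  have ch' : continuous (fun y => h (y - f (g y))).
    apply: (@continuous_fun_comp _ V V K^o _ h) => //.
    apply: continuous_funB; first by move=> y; exact: cvg_id.
    exact: continuous_fun_comp.
  rewrite g'fun => x; apply: cvgD; first exact: cg.
  apply: cvgZr_tmp; exact: ch'.
rewrite g'fun; split=> [y|x [a sx]].
  apply: subspaceD; [exact: subspace_lspan|exact: lspan_tail|].
  by apply: subspaceZ => //; exact: subspace_lspan.
have g'add u : lspan s u -> g (f u) + h (f u - f (g (f u))) *: d = u.
  by move=> su; rewrite gK// subrr linear0 scale0r addr0.
have gd : g (f d) = 0 by rewrite /d !linearB/= (gK (g (f e)))// subrr.
have xE : x = (x - a *: e + a *: g (f e)) + a *: d.
  by rewrite /d scalerBr [a *: e - _]addrC addrA addrK subrK.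
have su : lspan s (x - a *: e + a *: g (f e)).
  by apply: subspaceD => //; exact: subspaceZ.
move: xE su; set u := x - a *: e + a *: g (f e) => -> su.
clearbody d u.
have gE : g (f (u + a *: d)) = u.
  by rewrite !linearD !linearZ/= gd scaler0 addr0 gK.
rewrite gE; have -> : f (u + a *: d) - f u = a *: f d.
  by rewrite linearD linearZ/= addrAC subrr add0r.
by rewrite linearZ/= hd -[a%:A]/(a * 1) mulr1.
Qed.

Lemma findim_projection V (F : set V) : findim F ->
  exists2 P : {linear V -> V}, continuous P &
    (forall y, F (P y)) /\ (forall x, F x -> P x = x).
Proof.
move=> [s ->]; apply: (@lspan_left_inverse V V idfun s) => //.
by move=> x; exact: cvg_id.
Qed.

Lemma findim_closed V (F : set V) : findim F -> closed F.
Proof.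
move=> fF; have [P cP [FP PF]] := findim_projection fF.
suff -> : F = [set x | P x = x] by exact: closed_fixed.
by apply/seteqP; split=> x => [/PF//|/= <-].
Qed.

End FiniteDimension.

Section BanachIsomorphisms.
Context {K : numFieldType}.
Implicit Types U V : completeNormedModType K.

Lemma banach_iso_left_inverse U V (f : {linear U -> V}) (g : {linear V -> U})
    (A : set U) (B : set V) :
    continuous f -> continuous g -> is_subspace A -> closed A -> closed B ->
    f @` A = B -> (forall x, A x -> g (f x) = x) ->
  banach_iso f A B.
Proof.
move=> cf cg sA cA cB fAB gK; rewrite -fAB in cB *; split=> //.
- by split=> //; exact: subspace_image.
- apply: continuous_subspaceT => x; exact: cf.
- split; [by move=> x Ax; exists x| |by []].
  by move=> x y /set_mem Ax /set_mem Ay eq_f; rewrite -(gK x)// eq_f gK.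
- exists g; last by apply: continuous_subspaceT => y; exact: cg.
  by move=> x /set_mem; exact: gK.
Qed.

Lemma banach_iso_findim (functionals : enough_functionals (K := K)) U V
    (f : {linear U -> V}) (A : set U) (B : set V) :
    continuous f -> findim A -> f @` A = B ->
    (forall x, A x -> f x = 0 -> x = 0) ->
  banach_iso f A B.
Proof.
move=> cf fA fAB finj; have [s As] := fA; rewrite As in finj.
have [g cg [_ gK]] := lspan_left_inverse functionals cf finj.
apply: (@banach_iso_left_inverse _ _ f g) => //.
- exact: findim_subspace.
- exact: findim_closed.
- by rewrite -fAB; apply: findim_closed => //; exact: findim_image.
- by rewrite As.
Qed.

End BanachIsomorphisms.

(** * Iterated ranges and adapted complements *)

Section Ranges.
Context {K : numFieldType}.
Implicit Types X Y : completeNormedModType K.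

Lemma subspace_RS X Y (S : {linear X -> Y}) (T : {linear Y -> X}) n :
  is_subspace (RS S T n).
Proof.
elim: n X Y S T => [|n IH] X Y S T; first exact: subspaceT.
by apply: subspace_image; exact: IH.
Qed.

Lemma RS_succ X Y (S : {linear X -> Y}) (T : {linear Y -> X}) n :
  RS S T n.+1 `<=` RS S T n.
Proof.
elim: n X Y S T => [|n IH] X Y S T //.
by move=> _ [x /IH Rx <-]; exists x.
Qed.

Lemma RS_leq X Y (S : {linear X -> Y}) (T : {linear Y -> X}) m n :
  (m <= n)%N -> RS S T n `<=` RS S T m.
Proof.
move=> /subnK <-; elim: (n - m)%N => [|d IH] //.
by rewrite addSn => x /RS_succ/IH.
Qed.

(** [R_2] is the image under [S] of [range T], and modulo [N(S)] the latter is
    finite dimensional. *)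
Lemma findim_RS X Y (S : {linear X -> Y}) (T : {linear Y -> X}) n :
    fin_dim_quotient (range T) (null_space S `&` range T) -> (2 <= n)%N ->
  findim (RS S T n).
Proof.
move=> /fin_dim_quotient_lspan[s cov] n2.
apply: (@findim_sub _ _ _ (S @` lspan s)).
- exact: subspace_RS.
- move=> y /(RS_leq n2)[_ [z _ <-] <-].
  have [|w sw [Sw _]] := cov (T z); first by exists z.
  by exists w => //; apply/eqP; rewrite eq_sym -subr_eq0 -linearB; exact/eqP.
- by apply: findim_image; exists s.
Qed.

(** Downward induction on [n]: the complement found for [R_(n+1)] meets [N(T)]
    trivially, so it can be enlarged to a complement of [M^n] in [R_n]. *)
Lemma adapted_complement X Y (S : {linear X -> Y}) (T : {linear Y -> X}) N :
    (1 <= N)%N -> (forall n, (N <= n)%N -> RS S T n = RS S T N) ->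
    fin_dim_quotient (range S) (null_space T `&` range S) ->
  exists Y2 : set Y, [/\ findim Y2, Y2 `<=` range S &
    forall n, (1 <= n)%N ->
      splitting (RS S T n) (Mn S T n) (RS S T n `&` Y2)].
Proof.
move=> N1 stab /fin_dim_quotient_lspan[s cov].
have sN := subspace_null T; have sR := subspace_RS S T.
have step n (B : set Y) : (1 <= n)%N -> is_subspace B -> null_space T `<=` B ->
    exists2 F, findim F & splitting (RS S T n) (RS S T n `&` B) F.
  move=> n1 sB NB; apply: (@exists_complement _ _ _ _ s) => //.
  by move=> x /(RS_leq n1)/cov[y sy [/NB]]; exists y.
suff main d n : (1 <= n)%N -> (n + d)%N = N -> exists F, [/\ findim F,
    F `<=` RS S T n, forall y, null_space T y -> F y -> y = 0 &
    forall m y, (n <= m)%N -> RS S T m y ->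
      exists a b, [/\ Mn S T m a, (RS S T m `&` F) b & y = a + b]].
  have [F [fF FR FN cF]] := main (N - 1)%N 1%N (leqnn _) (subnKC N1).
  have sF := findim_subspace fF.
  exists F; split=> //.
  move=> n n1; split=> //.
  - by apply: subspaceI => //; exact: subspace_null.
  - exact: subspaceI.
  - by move=> y [].
  - by move=> y Ry; exact: cF.
  - by move=> y [_ Ny] [_ Fy]; exact: FN.
elim: d n => [|d IH] n n1 ndN.
  have [F fF [_ _ _ FR _ cF tF]] := step n _ n1 sN (@subset_refl _ _).
  exists F; split=> // [y Ny Fy|m y nm Ry].
    by apply: tF => //; split=> //; exact: FR.
  rewrite addn0 in ndN; rewrite /Mn stab -?ndN//.
  move: Ry; rewrite stab -?ndN// => /cF[a [b [[Ra Na] Fb ->]]].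
  by exists a, b; split=> //; split=> //; exact: FR.
have [|F [fF FR FN cF]] := IH n.+1 isT; first by rewrite addSn -addnS.
have sF := findim_subspace fF.
have [||G fG [_ _ _ GR _ cG tG]] :=
  step n [set a + b | a in null_space T & b in F] n1.
- exact: subspace_sum.
- by move=> a Na; exists a => //; exists 0; [exact: subspace0|rewrite addr0].
have sG := findim_subspace fG.
exists [set a + b | a in F & b in G]; split.
- exact: findim_sum.
- by move=> _ [a /FR/RS_succ Ra [b /GR Rb <-]]; apply: subspaceD.
- move=> y Ny [a Fa [b Gb abE]].
  have b0 : b = 0.
    apply: tG => //; split; first exact: GR.
    exists y => //; exists (- a); first exact: subspaceN.
    by rewrite -abE addrC addKr.
  by apply: FN => //; rewrite -abE b0 addr0.
- move=> m y; rewrite leq_eqVlt => /predU1P[<-|nm] Ry; last first.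
    have [a [b [Ma [Rb Fb] ->]]] := cF m y nm Ry.
    exists a, b; split=> //; split=> //; exists b => //.
    by exists 0; [exact: subspace0|rewrite addr0].
  have [c [g [[_ [a Na [b Fb cE]]] Gg]]] := cG y Ry; rewrite -cE => yE.
  have Rb : RS S T n b by exact/RS_succ/FR.
  have Rg : RS S T n g by exact: GR.
  exists a, (b + g); split; last by rewrite yE addrA.
    split=> //; have -> : a = y - (b + g) by rewrite yE -[a + b + g]addrA addrK.
    by apply: subspaceB => //; exact: subspaceD.
  by split; [exact: subspaceD|exists b => //; exists g].
Qed.

(** For [W] inside [R_n] this is the adaptedness condition
    [W = (W :&: N(T)) + (W :&: Y2)]. *)
Definition kernel_split X Y (T : {linear Y -> X}) (Y2 W : set Y) : Prop :=
  forall w, W w -> exists a b,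
    [/\ W a /\ null_space T a, W b /\ Y2 b & w = a + b].

(** [U] is the sum of a complement of [M^(n+1)] in [M^n] and of the part of
    [Y2] that [T] maps to [V'].  It is written as an intersection of preimages,
    from which closedness is immediate: [g \o T] is the projection of [R_n] to
    [Y2] along [N(T)], [P] is a projection to [M^(n+1)], and [U] consists of the
    [y] in [R_n] with [T y] in [V'] and [P (y - g (T y)) = 0]. *)
Lemma tilde_step (functionals : enough_functionals (K := K)) X Y
    (S : {linear X -> Y}) (T : {linear Y -> X}) (Y2 : set Y) n (V' : set X) :
    continuous T -> findim Y2 -> (1 <= n)%N ->
    (forall y, null_space T y -> Y2 y -> y = 0) ->
    (forall m, (1 <= m)%N ->
      splitting (RS S T m) (Mn S T m) (RS S T m `&` Y2)) ->
    findim (RS S T n.+1) -> closed (RS S T n) -> closed V' ->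
    splitting (RS T S n.+1) (RS T S n.+2) V' ->
  exists U, [/\ splitting (RS S T n) (RS S T n.+1) U, kernel_split T Y2 U,
    T @` U = V' & closed U].
Proof.
move=> cT [s Y2E] n1 Y2N adY fR cR cV [_ sV _ VR _ covV trV].
have sR := subspace_RS S T.
have [|g cg [_ gK]] := @lspan_left_inverse _ functionals _ _ T s cT.
  by move=> y; rewrite -Y2E => Yy Ty; exact: Y2N.
rewrite -Y2E in gK.
have sM m : is_subspace (Mn S T m).
  by apply: subspaceI => //; exact: subspace_null.
have fM : findim (Mn S T n.+1).
  by apply: findim_sub fR => // y [].
have [P cP [MP PM]] := findim_projection functionals fM.
have [L LE] : exists L : {linear Y -> Y}, forall y, L y = P (y - g (T y)).
  apply: linear_of_fun => a x y; rewrite -linearP; congr (P _).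
  by rewrite (linearP T) (linearP g) opprD addrACA -scalerBr.
have cL : continuous L.
  have -> : (L : Y -> Y) = fun y => P (y - g (T y)) by exact: funext.
  apply: continuous_fun_comp => //; apply: continuous_funB.
    by move=> y; exact: cvg_id.
  exact: continuous_fun_comp.
have Lker y : null_space T y -> L y = P y.
  by move=> Ty; rewrite LE Ty linear0 subr0.
have LY2 y : Y2 y -> L y = 0 by move=> Yy; rewrite LE gK// subrr linear0.
have NP y : null_space T (P y) by case: (MP y).
pose U := RS S T n `&` (T @^-1` V' `&` null_space L).
have sU : is_subspace U.
  apply: subspaceI => //; apply: subspaceI; last exact: subspace_null.
  exact: subspace_preimage.
exists U; split.
- split=> //; first exact: RS_succ.
  + by move=> y [].
  + move=> y Ry.
    have [m [b [[Rm Nm] [Rb Yb] yE]]] := splitting_cover (adY n n1) Ry.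
    have [|_ [v [[z Rz <-] Vv TyE]]] := covV (T y); first by exists y.
    have [mz [bz [[Rmz Nmz] [Rbz Ybz] zE]]] :=
      splitting_cover (adY n.+1 isT) Rz.
    (* [y] and [z] differ by a vector that [T] maps to [V'] but whose kernel part
       may have a component in [M^(n+1)]; adding that component to [z] removes
       it. *)
    have RPm : RS S T n.+1 (P (m - mz)) by case: (MP (m - mz)).
    have Rz' : RS S T n.+1 (z + P (m - mz)) by exact: subspaceD.
    exists (z + P (m - mz)), (y - (z + P (m - mz))).
    rewrite subrKC; split=> //; split.
      by apply: subspaceB => //; exact: RS_succ.
    split.
      by rewrite /= linearB linearD (NP (m - mz)) addr0 TyE addrC addKr.
    have LP : L (P (m - mz)) = P m - P mz.
      by rewrite (Lker _ (NP _)) (PM _ (MP _)) linearB.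
    have Ly : L y = P m by rewrite yE linearD (LY2 _ Yb) addr0 Lker.
    have Lz : L z = P mz by rewrite zE linearD (LY2 _ Ybz) addr0 Lker.
    by rewrite /null_space /= linearB linearD LP Ly Lz subrKC subrr.
  + move=> y Ry [_ [/= VTy Ly]].
    have Ty : T y = 0 by apply: trV => //; exists y.
    by rewrite -[y]PM// -Lker.
- move=> u [Ru [/= VTu Lu]].
  have [m [b [[Rm Nm] [Rb Yb] uE]]] := splitting_cover (adY n n1) Ru.
  have Ub : U b.
    split=> //; split; last exact: LY2.
    by move: VTu; rewrite uE /= linearD Nm add0r.
  have Um : U m.
    have -> : m = u - b by rewrite uE addrK.
    exact: subspaceB.
  by exists m, b.
- apply/seteqP; split=> [_ [y [_ [/= Vy _]] <-] //|v Vv].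
  have [y Ry vE] := VR _ Vv.
  have [m [b [[Rm Nm] [Rb Yb] yE]]] := splitting_cover (adY n n1) Ry.
  have Tb : T b = v by rewrite -vE yE linearD Nm add0r.
  by exists b => //; split=> //; split; [rewrite /= Tb|exact: LY2].
- apply: closedI => //; apply: closedI.
    exact: continuous_closed_preimage.
  exact: closed_null_space.
Qed.

End Ranges.

(** * Chains of tilde ranges *)

Section Chains.
Context {K : numFieldType}.

(** [alt_image] applies the maps from the outside; here the innermost step is
    exposed instead. *)
Lemma alt_image_shift (U V : lmodType K) (f : U -> V) (g : V -> U) A B n :
  alt_image n.+1 f g A B = alt_image n f g (g @` B) (f @` A).
Proof.
elim: n U V f g A B => [//|n IH] U V f g A B.
by rewrite -[LHS]/(f @` alt_image n.+1 g f B A) IH.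
Qed.

Lemma alt_image_zero (U V : lmodType K) (f : {linear U -> V})
    (g : {linear V -> U}) n :
  alt_image n f g [set 0] [set 0] = [set 0].
Proof.
elim: n U V f g => [//|n IH] U V f g /=; rewrite IH.
apply/seteqP; split=> [_ [_ -> <-]|_ ->]; first by rewrite /= linear0.
by exists 0; rewrite ?linear0.
Qed.

(** Telescoping of a descending chain [F] with successive complements [G]. *)
Lemma splitting_seq_chain (V : lmodType K) (F G : nat -> set V) m a :
    (forall n, (1 <= n)%N -> splitting (F n) (F n.+1) (G n)) -> (1 <= a)%N ->
  splitting_seq (F a) (F (a + m)%N :: [seq G i | i <- iota a m]).
Proof.
move=> FG; elim: m a => [|m IH] a a1.
  by rewrite addn0; apply: splitting_seq1; exact: splitting_whole (FG a a1).
have [B sB GB] := IH a.+1 isT.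
have [E sE sEB] := splitting_assoc (FG a a1) sB.
rewrite -addSnnS; exists E => //; exists B => //; exact: splittingC.
Qed.

Lemma splitting_seq_chain0 (V : lmodType K) (F G : nat -> set V) m a :
    (forall n, (1 <= n)%N -> splitting (F n) (F n.+1) (G n)) -> (1 <= a)%N ->
    F (a + m)%N = [set 0] ->
  splitting_seq (F a) [seq G i | i <- iota a m].
Proof.
move=> FG a1 F0; have [B] := @splitting_seq_chain V F G m a FG a1.
by rewrite F0 => /splitting0l ->.
Qed.

Implicit Types X Y : completeNormedModType K.

(** What [Y2] and the chain [R_n] contribute; used for [(S, T)] and, in the other
    space, for [(T, S)]. *)
Record adapted_side X Y (S : {linear X -> Y}) (T : {linear Y -> X})
    (F : set Y) : Prop := AdaptedSide {
  side_findim : findim F;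
  side_sub : F `<=` range S;
  side_injective : forall y, null_space T y -> F y -> y = 0;
  side_splitting : forall m, (1 <= m)%N ->
    splitting (RS S T m) (Mn S T m) (RS S T m `&` F);
  side_RS_findim : forall m, (2 <= m)%N -> findim (RS S T m);
  side_range_closed : closed (range S) }.

Lemma closed_range X Y (S : {linear X -> Y}) (S' : {linear Y -> X}) :
    continuous S -> continuous S' -> (forall x, S (S' (S x)) = S x) ->
  closed (range S).
Proof.
move=> cS cS' SS'S; have -> : range S = [set y | S (S' y) = y].
  by apply/seteqP; split=> [_ [x _ <-] //|y /= <-]; exists (S' y).
by apply: closed_fixed; exact: continuous_fun_comp.
Qed.

Lemma exists_adapted_side X Y (S : {linear X -> Y}) (T : {linear Y -> X}) N :
    closed (range S) -> (1 <= N)%N ->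
    (forall n, (N <= n)%N -> RS S T n = RS S T N) ->
    fin_dim_quotient (range S) (null_space T `&` range S) ->
    fin_dim_quotient (range T) (null_space S `&` range T) ->
  exists F, adapted_side S T F.
Proof.
move=> cR N1 stable fRS fRT.
have [F [fF FR spF]] := adapted_complement N1 stable fRS.
exists F; split=> //; last by move=> m; exact: findim_RS.
move=> y Ny Fy; have Ry := FR y Fy.
by apply: (splitting_trivial (spF 1%N isT)); split.
Qed.

Lemma side_range X Y (S : {linear X -> Y}) (T : {linear Y -> X}) (F : set Y) :
  adapted_side S T F -> RS S T 1 `&` F = F.
Proof. by move=> side; apply: setIidr; exact: side_sub side. Qed.

Lemma side_range_splitting X Y (S : {linear X -> Y}) (T : {linear Y -> X})
    (F : set Y) :
  adapted_side S T F ->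
  splitting (range S) (null_space T `&` range S) F.
Proof.
move=> side; have := side_splitting side (leqnn 1).
by rewrite (side_range side) /Mn setIC.
Qed.

Lemma exists_kernel_complement X Y (S : {linear X -> Y}) (T : {linear Y -> X}) :
    fin_dim_quotient (null_space S) (null_space S `&` range T) ->
  exists2 C, findim C &
    splitting (null_space S) (null_space S `&` range T) C.
Proof.
move=> /fin_dim_quotient_lspan[s cov].
apply: (@exists_complement _ _ _ _ s); first exact: subspace_null.
  exact: (subspace_RS T S 1).
by move=> x /cov[y sy [_ Rxy]]; exists y.
Qed.

(** [W] is admissible as the [n]-th tilde range [RSt]. *)
Definition tilde_chain X Y (S : {linear X -> Y}) (T : {linear Y -> X})
    (F W : set Y) n : Prop :=
  splitting (RS S T n) (RS S T n.+1) W /\ kernel_split T F W.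

Lemma side_closed (functionals : enough_functionals (K := K)) X Y
    (S : {linear X -> Y}) (T : {linear Y -> X}) (F : set Y) n :
  adapted_side S T F -> (1 <= n)%N -> closed (RS S T n).
Proof.
move=> side; case: n => [//|[|n]] _; first exact: side_range_closed side.
by apply: findim_closed => //; exact: (side_RS_findim side).
Qed.

(** Downward induction from the index where both chains are stationary and zero
    complements do; [tilde_step] is applied in both spaces at each stage. *)
Lemma exists_tilde_chain (functionals : enough_functionals (K := K)) X Y
    (S : {linear X -> Y}) (T : {linear Y -> X}) (F : set Y) (G : set X) N :
    continuous S -> continuous T ->
    adapted_side S T F -> adapted_side T S G ->
    (1 <= N)%N ->
    (forall n, (N <= n)%N -> RS S T n.+1 = RS S T n) ->
    (forall n, (N <= n)%N -> RS T S n.+1 = RS T S n) ->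
  exists (U : set Y) (V : set X), [/\ closed U, closed V &
    forall k, tilde_chain S T F (alt_image k S T V U) k.+1 /\
              tilde_chain T S G (alt_image k T S U V) k.+1].
Proof.
move=> cS cT sideF sideG N1 stabS stabT.
suff main d n : (1 <= n)%N -> (n + d)%N = N ->
    exists (U : set Y) (V : set X), [/\ closed U, closed V &
    forall k, tilde_chain S T F (alt_image k S T V U) (n + k)%N /\
              tilde_chain T S G (alt_image k T S U V) (n + k)%N].
  exact: (main (N - 1)%N 1%N isT (subnKC N1)).
elim: d n => [|d IH] n n1 ndN.
  exists [set 0], [set 0]; split; [exact: closed_zero|exact: closed_zero|].
  have zero_split X' Y' (S' : {linear X' -> Y'}) (T' : {linear Y' -> X'})
      (F' : set Y') m : is_subspace F' -> RS S' T' m.+1 = RS S' T' m ->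
      tilde_chain S' T' F' [set 0] m.
    move=> sF eqm; split; first by rewrite eqm; exact/splitting_zero/subspace_RS.
    move=> _ ->; exists 0, 0; rewrite addr0 /null_space /= linear0.
    by split=> //; split=> //; exact: subspace0.
  have Nk k : (N <= n + k)%N by rewrite -ndN addn0 leq_addr.
  move=> k; rewrite !alt_image_zero; split; apply: zero_split.
  - exact: findim_subspace (side_findim sideF).
  - exact: stabS.
  - exact: findim_subspace (side_findim sideG).
  - exact: stabT.
have [|U' [V' [cU' cV' chain']]] := IH n.+1 isT; first by rewrite addSnnS.
have [[/= sU' _] [sV' _]] := chain' 0%N; rewrite addn0 in sU' sV'.
have [U [sU kU TU cU]] := tilde_step functionals cT (side_findim sideF) n1
  (side_injective sideF) (side_splitting sideF)
  (side_RS_findim sideF (m := n.+1) n1)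
  (side_closed functionals sideF n1) cV' sV'.
have [V [sV kV SV cV]] := tilde_step functionals cS (side_findim sideG) n1
  (side_injective sideG) (side_splitting sideG)
  (side_RS_findim sideG (m := n.+1) n1)
  (side_closed functionals sideG n1) cU' sU'.
exists U, V; split=> // -[|k]; first by rewrite addn0.
by rewrite !alt_image_shift SV TU addnS -addSn; exact: chain'.
Qed.

Section Pieces.
Context {X Y : completeNormedModType K}.
Context (S : {linear X -> Y}) (T : {linear Y -> X}) (F : set Y).
Context (W : nat -> set Y).
Hypothesis side : adapted_side S T F.
Hypothesis chain : forall n, (1 <= n)%N -> tilde_chain S T F (W n) n.

Let sF : is_subspace F := findim_subspace (side_findim side).
Let sRS n : is_subspace (RS S T n) := subspace_RS S T n.
Let sN : is_subspace (null_space T) := subspace_null T.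

Lemma tilde_subspace n : (1 <= n)%N -> is_subspace (W n).
Proof. by move=> /chain[/splitting_r]. Qed.

Lemma tilde_sub_RS n : (1 <= n)%N -> W n `<=` RS S T n.
Proof. by move=> /chain[/splitting_subr]. Qed.

Lemma tilde_splitting n : (1 <= n)%N ->
  splitting (W n) (W n `&` null_space T) (W n `&` (RS S T n `&` F)).
Proof.
move=> n1; have sW := tilde_subspace n1; split.
- exact: subspaceI.
- by apply: subspaceI => //; exact: subspaceI.
- by move=> y [].
- by move=> y [].
- exact: sW.
- move=> w Ww; have [_ kW] := chain n1.
  have [a [b [[Wa Na] [Wb Fb] ->]]] := kW w Ww.
  by exists a, b; split=> //; split=> //; split=> //; exact: tilde_sub_RS Wb.
- by move=> y [_ Ny] [_ [_ Fy]]; exact: (side_injective side).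
Qed.

(** In a decomposition of [y] in [M^n] along [R_(n+1)] and [W n], the two
    components in [F] cancel, since their sum is in [N(T)]. *)
Lemma kernel_splitting n : (1 <= n)%N ->
  splitting (Mn S T n) (Mn S T n.+1) (W n `&` null_space T).
Proof.
move=> n1; have [sp _] := chain n1; have sW := tilde_subspace n1; split.
- exact: subspaceI.
- exact: subspaceI.
- by move=> y [/RS_succ Ry Ny].
- by move=> y [/(tilde_sub_RS n1) Ry Ny].
- exact: subspaceI.
- move=> y [Ry Ny]; have [z [w [Rz Ww yE]]] := splitting_cover sp Ry.
  have [m [b [Mm [Rb Fb] zE]]] :=
    splitting_cover (side_splitting side (m := n.+1) isT) Rz.
  have [a [c [[Wa Na] [Wc [Rc Fc]] wE]]] :=
    splitting_cover (tilde_splitting n1) Ww.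
  have bc0 : b + c = 0.
    apply: (side_injective side); last exact: subspaceD.
    have -> : b + c = y - (m + a).
      by rewrite yE zE wE addrACA [m + a + _]addrC addrK.
    by apply: subspaceB => //; apply: subspaceD => //; case: Mm.
  by exists m, a; split=> //; rewrite yE zE wE addrACA bc0 addr0.
- by move=> y [Ry _] [Wy _]; exact: (splitting_trivial sp).
Qed.

(** Here the two components in [N(T)] cancel. *)
Lemma complement_splitting n : (1 <= n)%N ->
  splitting (RS S T n `&` F) (RS S T n.+1 `&` F) (W n `&` (RS S T n `&` F)).
Proof.
move=> n1; have [sp _] := chain n1; have sW := tilde_subspace n1; split.
- exact: subspaceI.
- by apply: subspaceI => //; exact: subspaceI.
- by move=> y [/RS_succ Ry Fy].
- by move=> y [_].
- exact: subspaceI.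
- move=> y [Ry Fy]; have [z [w [Rz Ww yE]]] := splitting_cover sp Ry.
  have [m [b [[Rm Nm] Rb zE]]] :=
    splitting_cover (side_splitting side (m := n.+1) isT) Rz.
  have [a [c [[Wa Na] Wc wE]]] := splitting_cover (tilde_splitting n1) Ww.
  have ma0 : m + a = 0.
    apply: (side_injective side); first exact: subspaceD.
    have -> : m + a = y - (b + c) by rewrite yE zE wE addrACA addrK.
    case: Rb => _ Fb; case: Wc => _ [_ Fc].
    by apply: subspaceB => //; exact: subspaceD.
  by exists b, c; split=> //; rewrite yE zE wE addrACA ma0 add0r.
- by move=> y [Ry _] [Wy _]; exact: (splitting_trivial sp).
Qed.

(** [T] kills the part of [W n] in [N(T)], so the part in [F] has the same
    image. *)
Lemma tilde_iso (functionals : enough_functionals (K := K)) n :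
    continuous T -> (1 <= n)%N ->
  banach_iso T (W n `&` (RS S T n `&` F)) (T @` W n).
Proof.
move=> cT n1; have [sK sC _ CW _ cov _] := tilde_splitting n1.
apply: banach_iso_findim => //.
- apply: findim_sub sC _ (side_findim side).
  by move=> y [_ []].
- apply/seteqP; split=> [_ [y /CW Wy <-]|_ [y Wy <-]]; first by exists y.
  have [a [b [[_ Na] Cb ->]]] := cov y Wy.
  by exists b => //; rewrite linearD Na add0r.
- by move=> y [_ [_ Fy]] Ty; exact: (side_injective side).
Qed.

End Pieces.

(** * Lifting a complement of the second range *)

(** When [S'] is a generalized inverse of [S], the vectors fixed by [S' \o S] form
    a closed complement of [N(S)]; this is its part above [U]. *)
Definition section_space X Y (S : {linear X -> Y}) (S' : {linear Y -> X})
    (U : set Y) : set X := [set x | S' (S x) = x] `&` S @^-1` U.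

Section SectionSpace.
Context {X Y : completeNormedModType K}.
Context (S : {linear X -> Y}) (T : {linear Y -> X}) (S' : {linear Y -> X}).
Context (G : set X) (U : set Y).
Hypotheses (cS : continuous S) (cS' : continuous S').
Hypothesis SS'S : forall x, S (S' (S x)) = S x.
Hypothesis side : adapted_side T S G.
Hypothesis spU : splitting (range S) (RS S T 2) U.
Hypothesis cU : closed U.

Let sU : is_subspace U := splitting_r spU.

Lemma section_subspace : is_subspace (section_space S S' U).
Proof.
apply: subspaceI; last exact: subspace_preimage.
apply/subspaceP; split; first by rewrite /= !linear0.
by move=> a u v /= uE vE; rewrite !linearP uE vE.
Qed.

Lemma section_closed : closed (section_space S S' U).
Proof.
apply: closedI; last exact: continuous_closed_preimage.
by apply: closed_fixed; exact: continuous_fun_comp.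
Qed.

Lemma section_lift u : U u -> exists2 x, section_space S S' U x & S x = u.
Proof.
move=> Uu; have [x _ xE] := splitting_subr spU Uu.
exists (S' u); rewrite -xE; last exact: SS'S.
by split=> /=; rewrite SS'S// xE.
Qed.

Lemma section_image : S @` section_space S S' U = U.
Proof.
apply/seteqP; split=> [_ [x [_ Ux] <-] //|u /section_lift[x Xx <-]].
by exists x.
Qed.

Lemma section_preimage_iso (B : set Y) : is_subspace B -> closed B -> B `<=` U ->
  banach_iso S (section_space S S' U `&` S @^-1` B) B.
Proof.
move=> sB cB BU; apply: (@banach_iso_left_inverse _ _ _ S S') => //.
- by apply: subspaceI; [exact: section_subspace|exact: subspace_preimage].
- by apply: closedI; [exact: section_closed|exact: continuous_closed_preimage].
- apply/seteqP; split=> [_ [x [_ Bx] <-] //|b Bb].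
  have [x Xx xE] := section_lift (BU b Bb).
  by exists x => //; split; rewrite //= xE.
- by move=> x [[]].
Qed.

Lemma section_splitting (B C : set Y) : splitting U B C ->
  splitting (section_space S S' U)
    (section_space S S' U `&` S @^-1` B) (section_space S S' U `&` S @^-1` C).
Proof.
move=> [sB sC BU CU _ cov tr]; have sX := section_subspace; split.
- by apply: subspaceI => //; exact: subspace_preimage.
- by apply: subspaceI => //; exact: subspace_preimage.
- by move=> x [].
- by move=> x [].
- exact: sX.
- move=> x Xx; have [b [c [Bb Cc xE]]] := cov (S x) Xx.2.
  have [y Xy yE] := section_lift (BU b Bb).
  have [z Xz zE] := section_lift (CU c Cc).
  exists y, z; split; [by split; rewrite //= yE|by split; rewrite //= zE|].
  by rewrite -[x]Xx.1 xE -yE -zE linearD Xy.1 Xz.1.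
- move=> x [[xE _] /= Bx] [_ /= Cx].
  by rewrite -xE (tr (S x))// linear0.
Qed.

Lemma kernel_complement_splitting :
  splitting [set a + b | a in null_space S & b in G] (null_space S) G.
Proof.
have sG := findim_subspace (side_findim side).
have sN := subspace_null S; split=> //.
- by move=> a Na; exists a => //; exists 0; [exact: subspace0|rewrite addr0].
- by move=> b Gb; exists 0; [exact: subspace0|exists b => //; rewrite add0r].
- exact: subspace_sum.
- by move=> _ [a Na [b Gb <-]]; exists a, b.
- exact: (side_injective side).
Qed.

(** Modulo [N(S)], the space [X] is [range S], which [R_2] and [U] split, and
    [R_2] is the image of [G]. *)
Lemma whole_splitting :
  splitting [set: X] [set a + b | a in null_space S & b in G]
    (section_space S S' U).
Proof.
have spG := kernel_complement_splitting.
split=> //.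
- exact: splitting_whole spG.
- exact: section_subspace.
- exact: subspaceT.
- move=> x _; have [r [u [[_ [y _ <-] <-] Uu SxE]]] :=
    splitting_cover spU (imageT S x).
  have [z Xz zE] := section_lift Uu.
  have [|m [b [[_ Nm] [_ Gb] yE]]] :=
      splitting_cover (side_splitting side (m := 1%N) isT) (w := T y).
    by exists y.
  exists (x - z), z; rewrite subrK; split=> //.
  exists (x - z - b); last by exists b; rewrite ?subrK.
  have SbE : S b = S (T y) by rewrite yE linearD Nm add0r.
  by rewrite /null_space /= !linearB SxE SbE zE addrK subrr.
- move=> _ [a Na [b Gb <-]] [xE Ux]; rewrite -xE.
  rewrite (splitting_trivial spU (x := S (a + b)))// ?linear0//.
  have [y _ <-] := side_sub side Gb.
  by rewrite linearD Na add0r; exists (T y) => //; exists y.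
Qed.

Lemma whole_splitting_seq (L1 L2 L3 : seq (set X)) :
    splitting_seq (null_space S) L1 -> splitting_seq G L2 ->
    splitting_seq (section_space S S' U) L3 ->
  splitting_seq [set: X] (L1 ++ L2 ++ L3).
Proof.
move=> L1E L2E L3E; rewrite catA; apply: splitting_seq_cat whole_splitting _ L3E.
exact: splitting_seq_cat kernel_complement_splitting L1E L2E.
Qed.

End SectionSpace.

End Chains.

(** * Stationary chains *)

Section Stabilisation.
Context {K : numFieldType} {X Y : completeNormedModType K}.
Context (S : {linear X -> Y}) (T : {linear Y -> X}) (p : nat).
Hypothesis stable : stable_from (RS S T) p.

Lemma stable_RS n : (p <= n)%N -> RS S T n = RS S T p.
Proof. by move=> /subnKC <-; rewrite -stable. Qed.

Lemma stable_RT n : (p.+1 <= n)%N -> RS T S n = RS T S p.+1.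
Proof.
case: n => // n pn; rewrite -[LHS]/(T @` RS S T n) -[RHS]/(T @` RS S T p).
by rewrite stable_RS.
Qed.

Hypothesis findim_RSp : findim (RS S T p).

Lemma stable_RS_surjective : RS S T p `<=` (S \o T) @` RS S T p.
Proof.
move=> z Rz; have : RS S T p.+2 z by rewrite stable_RS// -addn2 leq_addr.
by move=> [_ [w Rw <-] <-]; exists w.
Qed.

(** A surjective endomorphism of a finite dimensional space is injective. *)
Lemma stable_RS_injective y : RS S T p y -> T y = 0 -> y = 0.
Proof.
move=> Ry Ty.
apply: (@findim_surjective_injective _ _ (S \o T) (RS S T p)) => //.
  exact: stable_RS_surjective.
by rewrite /= Ty linear0.
Qed.

Lemma stable_RT_injective x : RS T S p.+1 x -> S x = 0 -> x = 0.
Proof.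
move=> [y Ry <-] STy; rewrite (_ : y = 0) ?linear0//.
apply: (@findim_surjective_injective _ _ (S \o T) (RS S T p)) => //.
exact: stable_RS_surjective.
Qed.

Lemma stable_complement_Y (F : set Y) :
    splitting (RS S T p) (Mn S T p) (RS S T p `&` F) ->
  Mn S T p = [set 0] /\ RS S T p `&` F = RS S T p.
Proof.
move=> sp; have M0 : Mn S T p = [set 0].
  apply/seteqP; split=> [y [Ry Ty]|_ ->]; first exact: stable_RS_injective.
  exact: (subspace0 (splitting_l sp)).
by split=> //; apply/esym/splitting0l; rewrite -M0.
Qed.

Lemma stable_kernel_X : Nn S T p.+1 = [set 0].
Proof.
apply/seteqP; split=> [x [Rx Sx]|_ ->]; first exact: stable_RT_injective.
split; last by rewrite /null_space /= linear0.
exact: (subspace0 (subspace_RS T S p.+1)).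
Qed.

(** [S] is injective on [G] and maps both sides onto [R_p]: the left one since
    [R_p = S(R'_(p-1))], the right one since [R_p = R_(p+2)]. *)
Lemma stable_complement_X (G : set X) :
    (2 <= p)%N -> adapted_side T S G ->
  RS T S (p - 1) `&` G = RS T S p.+1.
Proof.
move=> p2 side; have p1 : (1 <= p - 1)%N by rewrite subn_gt0.
have sp := side_splitting side (m := p.+1) isT.
have RG : RS T S p.+1 `&` G = RS T S p.+1.
  by apply/esym/splitting0l; rewrite -stable_kernel_X.
apply/seteqP; split=> x; last first.
  rewrite -{1}RG => -[Rx Gx]; split=> //; apply: RS_leq Rx.
  by rewrite (leq_trans (leq_subr 1 p)).
move=> [Rx Gx].
have : RS S T p.+2 (S x).
  rewrite stable_RS; last by rewrite -addn2 leq_addr.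
  have -> : p = (p - 1).+1 by rewrite subn1 prednK// ltnW.
  by exists x.
move=> [z Rz Szx].
suff -> : x = z by [].
have [_ Gz] : (RS T S p.+1 `&` G) z by rewrite RG.
apply/eqP; rewrite -subr_eq0; apply/eqP; apply: (side_injective side).
  by rewrite /null_space /= linearB Szx subrr.
by apply: subspaceB => //; exact: findim_subspace (side_findim side).
Qed.

End Stabilisation.

Unset Implicit Arguments.

Theorem theorem3p11 (R : realType) (k : scalar_kind)
    (X Y : completeNormedModType (scalar_field R k))
    (S : {linear X -> Y}) (T : {linear Y -> X}) (p : nat)
    (hST : regular_fredholm_pair S T)
    (hcase : has_case S T CaseII p) (hp : (2 <= p)%N) :
  exists D : subspace_system X Y,
  [/\ decomposition_system S T D /\ adapted S T D,
      direct_sum [set: X]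
        ((X1 D :: [seq NN S T D i | i <- iota 1 p]) ++
         (X2n S T D (p - 1) :: [seq XX2 S T D i | i <- iota 1 (p - 2)]) ++
         [:: XtN S T D; Xt2 S T D]) /\
      direct_sum [set: Y]
        ((Y1 D :: [seq MM S T D j | j <- iota 1 (p - 1)]) ++
         (Y2n S T D p :: [seq YY2 S T D j | j <- iota 1 (p - 1)]) ++
         [:: YtN S T D; Yt2 S T D]),
      [/\ forall x, sum_space (X1 D :: [seq NN S T D i | i <- iota 1 p]) x ->
            S x = 0,
          banach_iso S (X2n S T D (p - 1)) (Y2n S T D p),
          forall i, (1 <= i <= p - 2)%N ->
            banach_iso_sum S (XX2 S T D i) [:: MM S T D i.+1; YY2 S T D i.+1],
          banach_iso S (XtN S T D) (MM S T D 1) &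
          banach_iso S (Xt2 S T D) (YY2 S T D 1)],
      [/\ forall y, sum_space (Y1 D :: [seq MM S T D j | j <- iota 1 (p - 1)]) y ->
            T y = 0,
          banach_iso T (Y2n S T D p) (X2n S T D (p - 1)),
          (forall j, (1 <= j <= p - 3)%N ->
             banach_iso_sum T (YY2 S T D j) [:: NN S T D j.+1; XX2 S T D j.+1]) /\
          (forall l, (1 <= l)%N -> l = (p - 2)%N \/ l = (p - 1)%N ->
             banach_iso T (YY2 S T D l) (NN S T D l.+1)),
          banach_iso T (YtN S T D) (NN S T D 1) &
          banach_iso T (Yt2 S T D) (XX2 S T D 1)] &
      p = 2%N -> XX2 S T D 1 = [set 0] /\ Yt2 S T D = [set 0]].
Proof.
(* The scalar field matters only through its continuous linear forms. *)
have functionals := @scalar_field_enough_functionals R k.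
move: functionals X Y S T hST hcase.
move: (scalar_field R k) => K functionals X Y S T.
move=> [/bounded_linear_continuous cS /bounded_linear_continuous cT].
move=> [fNS fRT fNT fRS] [S' /bounded_linear_continuous cS' SS'S].
move=> [T' /bounded_linear_continuous cT' TT'T].
move=> [p' [q' [[_ stable _] _ pE p'q']]].
have {p' q' pE p'q' stable} stable : stable_from (RS S T) p.
  by rewrite pE (minn_idPl (ltnW p'q')).
have p1 : (1 <= p)%N by exact: ltnW.
have [F sideF] := exists_adapted_side (closed_range cS cS' SS'S) p1
  (stable_RS stable) fRS fRT.
have [G sideG] := exists_adapted_side (closed_range cT cT' TT'T)
  (isT : (1 <= p.+1)%N) (stable_RT stable) fRT fRS.
have [|n pn|n pn|U [V [cU cV chain]]] :=
    @exists_tilde_chain _ functionals X Y S T F G p.+1 cS cT sideF sideG.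
- by [].
- by rewrite !(stable_RS stable)// ltnW// ltnW.
- by rewrite !(stable_RT stable)// ltnW.
have [B fB spB] := exists_kernel_complement fNS.
have [C fC spC] := exists_kernel_complement fNT.
have fF := side_findim sideF; have fG := side_findim sideG.
pose D := @SubspaceSystem K X Y
  B G (section_space S S' U) C F (section_space T T' V).
(* The lifted spaces are chosen so that the tilde ranges of the system are the
   chain above, with the index shifted by one. *)
have [[/= spU _] [spV _]] := chain 0%N.
have RStE n : RSt S T D n.+1 = alt_image n S T V U.
  by rewrite /RSt alt_image_shift (section_image SS'S spU)
     (section_image TT'T spV).
have RTtE n : RTt S T D n.+1 = alt_image n T S U V.
  by rewrite /RTt alt_image_shift (section_image SS'S spU)
     (section_image TT'T spV).
have chainS n : (1 <= n)%N -> tilde_chain S T F (RSt S T D n) n.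
  by case: n => // n _; rewrite RStE; case: (chain n).
have chainT n : (1 <= n)%N -> tilde_chain T S G (RTt S T D n) n.
  by case: n => // n _; rewrite RTtE; case: (chain n).
have RS1 : RSt S T D 1 = U by rewrite RStE.
have RT1 : RTt S T D 1 = V by rewrite RTtE.
have p_1 : (1 <= p - 1)%N by rewrite subn_gt0.
have fRp : findim (RS S T p) by exact: side_RS_findim sideF _ hp.
have [M0 RF] := stable_complement_Y stable fRp (side_splitting sideF p1).
have N0 := stable_kernel_X stable fRp.
have RG := stable_complement_X stable fRp hp sideG.
(* From [p - 1] on, the part of the chain in [G] is stationary. *)
have XX0 n : (p - 1 <= n)%N -> XX2 S T D n = [set 0].
  move=> pn; have n1 := leq_trans p_1 pn.
  have sp := complement_splitting sideG chainT n1.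
  apply/seteqP; split=> [x Wx|_ ->]; last exact: (subspace0 (splitting_r sp)).
  apply: (splitting_trivial sp) => //; have [Wx' [Rx Gx]] := Wx; split=> //.
  have : RS T S p.+1 x by rewrite -RG; split=> //; exact: RS_leq pn _ Rx.
  have [np|pn'] := leqP n p; first exact: RS_leq.
  by rewrite -(stable_RT stable (n := n.+1))// ltnS ltnW.
have sXt := section_subspace S' spU; have sYt := section_subspace T' spV.
have spX1 : splitting U (MM S T D 1) (YY2 S T D 1).
  rewrite -{1}RS1; exact: (tilde_splitting sideF chainS).
have spY1 : splitting V (NN S T D 1) (XX2 S T D 1).
  rewrite -{1}RT1; exact: (tilde_splitting sideG chainT).
have Xwhole := whole_splitting_seq SS'S sideG spU.
have Ywhole := whole_splitting_seq TT'T sideF spV.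
have closedMM : closed (MM S T D 1).
  by rewrite /MM RS1; apply: closedI => //; exact: closed_null_space.
have closedNN : closed (NN S T D 1).
  by rewrite /NN RT1; apply: closedI => //; exact: closed_null_space.
have closedYY : closed (YY2 S T D 1).
  apply: findim_closed => //; apply: findim_sub fF; last by move=> y [_ []].
  exact: splitting_r spX1.
have closedXX : closed (XX2 S T D 1).
  apply: findim_closed => //; apply: findim_sub fG; last by move=> y [_ []].
  exact: splitting_r spY1.
exists D; split.
- split.
    split.
    + by split; exact: findim_subspace.
    + by split; exact: findim_fin_dim.
    + split=> //; exact: section_closed.
    + split; [exact: splitting_direct_sum| |].
        exact/splitting_direct_sum/side_range_splitting.
      apply: splitting_seq_direct_sum.
      apply: (Xwhole [:: _; _] [:: G] [:: section_space S S' U]).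
      * exact: splitting_seq2.
      * by apply: splitting_seq1; exact: findim_subspace.
      * exact: splitting_seq1.
    + split; [exact: splitting_direct_sum| |].
        exact/splitting_direct_sum/side_range_splitting.
      apply: splitting_seq_direct_sum.
      apply: (Ywhole [:: _; _] [:: F] [:: section_space T T' V]).
      * exact: splitting_seq2.
      * by apply: splitting_seq1; exact: findim_subspace.
      * exact: splitting_seq1.
  move=> n n1; split.
  + split; apply: splitting_direct_sum.
      exact: side_splitting sideF _ _.
    exact: side_splitting sideG _ _.
  + split; apply: splitting_direct_sum.
      exact: (tilde_splitting sideF chainS n1).
    exact: (tilde_splitting sideG chainT n1).
  + by apply: splitting_direct_sum; case: (chainS n n1).
  + by apply: splitting_direct_sum; case: (chainT n n1).
- split; apply: splitting_seq_direct_sum.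
  + apply: (Xwhole (X1 D :: [seq NN S T D i | i <- iota 1 p])
      (X2n S T D (p - 1) :: [seq XX2 S T D i | i <- iota 1 (p - 2)])
      [:: XtN S T D; Xt2 S T D]).
    * exists (null_space S `&` range T); first exact: splittingC.
      rewrite setIC.
      apply: (splitting_seq_chain0 (kernel_splitting sideG chainT) (leqnn 1)).
      exact: N0.
    * rewrite -[in splitting_seq G](side_range sideG).
      have -> : (p - 1)%N = (1 + (p - 2))%N by rewrite addnBA.
      exact: (splitting_seq_chain _ (complement_splitting sideG chainT)
        (leqnn 1)).
    * exact: (splitting_seq2 (section_splitting SS'S spU spX1)).
  + apply: (Ywhole (Y1 D :: [seq MM S T D j | j <- iota 1 (p - 1)])
      (Y2n S T D p :: [seq YY2 S T D j | j <- iota 1 (p - 1)])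
      [:: YtN S T D; Yt2 S T D]).
    * exists (null_space T `&` range S); first exact: splittingC.
      rewrite setIC.
      apply: (splitting_seq_chain0 (kernel_splitting sideF chainS) (leqnn 1)).
      by rewrite subnKC.
    * rewrite -[in splitting_seq F](side_range sideF).
      have -> : Y2n S T D p = RS S T (1 + (p - 1)) `&` F by rewrite subnKC.
      exact: (splitting_seq_chain _ (complement_splitting sideF chainS)
        (leqnn 1)).
    * exact: (splitting_seq2 (section_splitting TT'T spV spY1)).
- have X2E : X2n S T D (p - 1) = RS T S p.+1 := RG.
  have Y2E : Y2n S T D p = RS S T p := RF.
  split.
  + move=> x; apply: sum_space_null => -[_|i]; first exact: splitting_subr spB.
    by rewrite /= size_map => ip; rewrite (nth_map 0%N)// => z [].
  + rewrite X2E Y2E; apply: banach_iso_findim => //.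
    * exact: side_RS_findim sideG _ _.
    * by rewrite -(stable_RS stable (n := p.+2))// -addn2 leq_addr.
    * exact: stable_RT_injective.
  + move=> i /andP[i1 _]; exists (RSt S T D i.+1).
      exact: splitting_direct_sum (tilde_splitting sideF chainS _).
    exact: (tilde_iso sideG chainT functionals cS i1).
  + apply: (section_preimage_iso cS cS' SS'S spU cU) => //.
      exact: splitting_l spX1.
    exact: splitting_subl spX1.
  + apply: (section_preimage_iso cS cS' SS'S spU cU) => //.
      exact: splitting_r spX1.
    exact: splitting_subr spX1.
- have X2E : X2n S T D (p - 1) = RS T S p.+1 := RG.
  have Y2E : Y2n S T D p = RS S T p := RF.
  split.
  + move=> y; apply: sum_space_null => -[_|i]; first exact: splitting_subr spC.
    by rewrite /= size_map => ip; rewrite (nth_map 0%N)// => z [].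
  + rewrite X2E Y2E; apply: banach_iso_findim => //.
    exact: stable_RS_injective.
  + split.
      move=> j /andP[j1 _]; exists (RTt S T D j.+1).
        exact: splitting_direct_sum (tilde_splitting sideG chainT _).
      exact: (tilde_iso sideF chainS functionals cT j1).
    move=> l l1 lp; have pl : (p - 1 <= l.+1)%N.
      by case: lp => ->; rewrite ?leqnSn// -subSn// subSS.
    have -> : NN S T D l.+1 = RTt S T D l.+1.
      apply/esym/splitting0l/splittingC; rewrite -(XX0 l.+1 pl).
      exact: (tilde_splitting sideG chainT (isT : (1 <= l.+1)%N)).
    exact: (tilde_iso sideF chainS functionals cT l1).
  + apply: (section_preimage_iso cT cT' TT'T spV cV) => //.
      exact: splitting_l spY1.
    exact: splitting_subl spY1.
  + apply: (section_preimage_iso cT cT' TT'T spV cV) => //.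
      exact: splitting_r spY1.
    exact: splitting_subr spY1.
- move=> p2; have X0 : XX2 S T D 1 = [set 0] by apply: XX0; rewrite p2.
  split=> //; rewrite /Yt2 X0; apply/seteqP; split=> [y [[yE _] /= Ty]|_ ->].
    by rewrite -yE Ty linear0.
  by split; [exact: (subspace0 sYt)|rewrite /= linear0].
Qed.
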